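(* Let $k\ge 2$, let $\Gamma\cong\mathbb{Z}/k\mathbb{Z}$ be the group of rotations of $\mathbb{R}^2$ about the origin generated by the rotation through angle $2\pi/k$, and let $(\tilde G,\varphi)$ be a finite graph with a $\Gamma$-action $\varphi$ that is free on vertices and edges, with associated colored quotient graph $(G,\boldsymbol\gamma)$ on $n$ vertices. Then a generic rotation framework on $(\tilde G,\varphi)$ is minimally rigid if and only if $(G,\boldsymbol\gamma)$ is cone-Laman. That is, there is a proper algebraic subset $Z\subset\mathbb{R}^{2n}$ such that for every $\mathbf p=(\mathbf p_i)_{i\in V(G)}\in\mathbb{R}^{2n}\setminus Z$, the symmetric realization $\tilde G(\mathbf p)$ determined by $\mathbf p$ (with the edge lengths it induces) is minimally rigid if and only if $(G,\boldsymbol\gamma)$ is cone-Laman.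
   Context: Graphs are finite nonempty multigraphs. A $\Gamma$-framework is a triple $(\tilde G,\varphi,\tilde{\boldsymbol\ell})$, where $\tilde G$ is a finite graph, $\varphi$ is a $\Gamma$-action on $\tilde G$ that is free on vertices and on edges, and $\tilde{\boldsymbol\ell}=(\ell_{ij})_{ij\in E(\tilde G)}$ is a vector of positive edge lengths (in particular $\tilde G$ has no self-loops). When $\Gamma$ is a finite group of rotations it is called a rotation (or cone) framework. A realization $\tilde G(\mathbf p)$ is an assignment of points $\mathbf p_i\in\mathbb{R}^2$ to $i\in V(\tilde G)$ such that $\|\mathbf p_j-\mathbf p_i\|^2=\ell_{ij}^2$ for all $ij\in E(\tilde G)$ and $\mathbf p_{\varphi(\gamma)\cdot i}=\gamma\cdot\mathbf p_i$ for all $\gamma\in\Gamma$, $i\in V(\tilde G)$. Let $\mathcal R(\tilde G,\varphi,\tilde{\boldsymbol\ell})$ be the space of all realizations; the configuration space is $\mathcal R(\tilde G,\varphi,\tilde{\boldsymbol\ell})/\mathrm{Cent}(\Gamma)$, where $\mathrm{Cent}(\Gamma)$ is the centralizer of $\Gamma$ in the group $\mathrm{Euc}(2)$ of isometries of $\mathbb{R}^2$. A realization is rigid if it is isolated in the configuration space, and minimally rigid if it is rigid but ceases to be so after removing any $\Gamma$-orbit of edges from $\tilde G$. Colored quotient. Identify $\Gamma$ with $\mathbb{Z}/k\mathbb{Z}$. A colored graph $(G,\boldsymbol\gamma)$ is a finite directed graph $G$ with a color $\gamma_{ij}\in\mathbb{Z}/k\mathbb{Z}$ on each edge $ij$. The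 colored quotient of $(\tilde G,\varphi)$ has $G=\tilde G/\Gamma$: choose a representative $\tilde i_0$ in each vertex orbit $i$ and put $\tilde i_\gamma=\varphi(\gamma)\cdot\tilde i_0$; orient each edge orbit $ij$, and let $\gamma_{ij}$ be the color such that the orbit consists of the edges $\tilde i_\gamma\tilde j_{\gamma+\gamma_{ij}}$, $\gamma\in\mathbb{Z}/k\mathbb{Z}$. A point $\mathbf p=(\mathbf p_i)_{i\in V(G)}\in\mathbb{R}^{2n}$ determines a symmetric placement by $\mathbf p_{\tilde i_\gamma}=\gamma\cdot\mathbf p_i$. The map $\rho:H_1(G,\mathbb{Z})\to\mathbb{Z}/k\mathbb{Z}$ is the homomorphism defined on oriented cycles by adding up the colors of the traversed edges, with a minus sign for edges traversed in reverse. A subgraph has trivial $\rho$-image if $\rho$ vanishes on all its cycles. $(G,\boldsymbol\gamma)$ with $n$ vertices and $m$ edges is cone-Laman if $m=2n-1$ and every subgraph $G'$ spanned by a nonempty set of edges, with $n'$ vertices, $m'$ edges, $c'$ connected components with non-trivial $\rho$-image and $c_0'$ connected components with trivial $\rho$-image, satisfies $m'\le 2n'-c'-3c_0'$. *)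

(* Defs.v *)
From HB Require Import structures.
(* Without its notations, which clash with those of MathComp-Analysis, and first,
   because it redefines [symmetric]. *)
From mathcomp Require Import -(notations) mpoly.
From mathcomp Require Import all_boot all_order all_algebra all_fingroup.
From mathcomp Require Import generic_quotient.
From mathcomp Require Import all_classical all_reals all_analysis.

Set Implicit Arguments.
Unset Strict Implicit.
Unset Printing Implicit Defensive.

Import Order.TTheory GRing.Theory Num.Theory.
Import numFieldNormedType.Exports.

Local Open Scope classical_set_scope.
Local Open Scope ring_scope.
Local Open Scope quotient_scope.

(* Finite multigraphs, loops allowed. As a directed graph, [edge_src] and
   [edge_dst] are the orientation; as an undirected graph, they only fix an
   arbitrary order on the two endpoints of each edge. *)
Record mgraph : Type := MGraph {
  vertex : finType;
  edge : finType;
  edge_src : edge -> vertex;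
  edge_dst : edge -> vertex }.

Definition ends (G : mgraph) (e : edge G) : {set vertex G} :=
  [set edge_src e; edge_dst e]%SET.

Definition loopless (G : mgraph) : Prop :=
  forall e : edge G, edge_src e != edge_dst e.

Definition del_edges (G : mgraph) (A : {set edge G}) : mgraph :=
  @MGraph (vertex G) {e : edge G | e \notin A}
    (fun e => edge_src (val e)) (fun e => edge_dst (val e)).

Definition free_action (gT : finGroupType) (T : finType)
    (to : {action gT &-> T}) : Prop :=
  forall (x : T) (g : gT), to x g = x -> g = 1%g.

(* The group law of the finGroupType 'Z_k is addition. Since 'Z_0 and 'Z_1 are
   'Z_2, everything below is meant for 1 < k. The action on vertices is not
   required to commute with the order of endpoints chosen in [mgraph]. *)
Record sym_graph (k : nat) : Type := SymGraph {
  sg_graph :> mgraph;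
  sg_nonempty : (0 < #|vertex sg_graph|)%N;
  actV : {action 'Z_k &-> vertex sg_graph};
  actE : {action 'Z_k &-> edge sg_graph};
  ends_act : forall (e : edge sg_graph) (g : 'Z_k),
    ends (actE e g) = [set actV x g | x in ends e]%SET;
  actV_free : free_action actV;
  actE_free : free_action actE }.

Record colored_graph (k : nat) : Type := ColoredGraph {
  cg_graph :> mgraph;
  color : edge cg_graph -> 'Z_k }.

(* C is the colored quotient of H for the vertex representatives [rep], and the
   orientation of the edge orbits that C carries. The fibres of [projV] and
   [projE] are the orbits, [lift_vertex i g] is the vertex i_g of H, and the
   edges of H over the edge ij of C are the i_g j_(g + color ij). *)
Record colored_quotient (k : nat) (H : sym_graph k) (C : colored_graph k) :
    Type := ColoredQuotient {
  projV : vertex H -> vertex C;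
  projE : edge H -> edge C;
  projV_orbit : forall x y : vertex H,
    projV x = projV y <-> y \in orbit (actV H) [set: 'Z_k]%SET x;
  projE_orbit : forall e f : edge H,
    projE e = projE f <-> f \in orbit (actE H) [set: 'Z_k]%SET e;
  rep : vertex C -> vertex H;
  rep_proj : forall i : vertex C, projV (rep i) = i;
  lift_vertex := fun (i : vertex C) (g : 'Z_k) => actV H (rep i) g;
  edge_lift : forall e : edge C, exists e0 : edge H, forall g : 'Z_k,
    projE (actE H e0 g) = e /\
    ends (actE H e0 g) =
      [set lift_vertex (edge_src e) g;
           lift_vertex (edge_dst e) (g + color e)]%SET }.

Section ConeLaman.
Variables (k : nat) (C : colored_graph k).
Implicit Types A : {set edge C}.

Definition boundary (z : {ffun edge C -> int}) (v : vertex C) : int :=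
  \sum_(e | edge_dst e == v) z e - \sum_(e | edge_src e == v) z e.

(* H_1 of a graph is its group of integral 1-cycles: an oriented cycle is the
   chain counting traversals of each edge, negatively when reversed. *)
Definition H1 A : set {ffun edge C -> int} :=
  [set z : {ffun edge C -> int} |
    (forall e, e \notin A -> z e = 0) /\ forall v, boundary z v = 0].

Definition rho (z : {ffun edge C -> int}) : 'Z_k :=
  \sum_(e : edge C) color e *~ z e.

Definition trivial_rho A : Prop := forall z, H1 A z -> rho z = 0.

Definition span_vertices A : {set vertex C} := \bigcup_(e in A) ends e.

Definition adjacent A : rel (vertex C) :=
  fun x y => [exists e in A, ends e == [set x; y]%SET].

Definition components A : {set {set vertex C}} :=
  equivalence_partition (connect (adjacent A)) (span_vertices A).

Definition edges_in A (X : {set vertex C}) : {set edge C} :=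
  [set e in A | ends e \subset X]%SET.

Definition n_nontrivial A : nat :=
  #|[set X in components A | `[< ~ trivial_rho (edges_in A X) >]]%SET|.

Definition n_trivial A : nat :=
  #|[set X in components A | `[< trivial_rho (edges_in A X) >]]%SET|.

Definition cone_laman : Prop :=
  #|edge C|%:Z = 2 * #|vertex C|%:Z - 1 /\
  forall A : {set edge C}, A != finset.set0 ->
    #|A|%:Z <=
      2 * #|span_vertices A|%:Z - (n_nontrivial A)%:Z - 3 * (n_trivial A)%:Z.

End ConeLaman.

Section Plane.
Variable R : realType.

(* The library norm on 'cV[R]_2 is the sup norm; its topology is the usual
   one, but distances have to be Euclidean. *)
Definition sqnorm (u : 'cV[R]_2) : R := \sum_(i < 2) u i 0 ^+ 2.

Definition edist (u v : 'cV[R]_2) : R := Num.sqrt (sqnorm (v - u)).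

Definition rotation_mx (t : R) : 'M[R]_2 :=
  \matrix_(i, j) (if i == j then cos t
                  else if i == 0 then - sin t else sin t).

Definition rot (k : nat) (g : 'Z_k) (u : 'cV[R]_2) : 'cV[R]_2 :=
  rotation_mx ((g : nat)%:R * (2 * pi / k%:R)) *m u.

Definition Euc2 : set ('cV[R]_2 -> 'cV[R]_2) :=
  [set f | bijective f /\ forall u v, edist (f u) (f v) = edist u v].

Definition Cent (k : nat) : set ('cV[R]_2 -> 'cV[R]_2) :=
  [set f | Euc2 f /\ forall (g : 'Z_k) u, f (rot g u) = rot g (f u)].

Lemma Cent_id k : Cent k id.
Proof. by split=> //; split=> //; exists id. Qed.

Lemma Cent_comp k f h : Cent k f -> Cent k h -> Cent k (f \o h).
Proof.
move=> [[fb fd] fr] [[hb hd] hr]; split; first split.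
- exact: bij_comp.
- by move=> u v /=; rewrite fd hd.
- by move=> g u /=; rewrite hr fr.
Qed.

Lemma Cent_inv k f h : Cent k f -> cancel f h -> cancel h f -> Cent k h.
Proof.
move=> [[_ fd] fr] fK hK; split; first split.
- by exists f.
- by move=> u v; rewrite -fd !hK.
- by move=> g u; rewrite -{1}(hK u) -fr fK.
Qed.

End Plane.

Section Frameworks.
Variables (R : realType) (k : nat) (G : mgraph).
Variables (aV : {action 'Z_k &-> vertex G}) (len : edge G -> R).

Definition placement : Type := {ptws vertex G -> 'cV[R]_2}.
HB.instance Definition _ := Topological.on placement.

Definition realizations : set placement :=
  [set p : placement |
    (forall e : edge G, edist (p (edge_src e)) (p (edge_dst e)) ^+ 2
                        = len e ^+ 2) /\
    forall (g : 'Z_k) (i : vertex G), p (aV i g) = rot g (p i)].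

(* The subspace topology on realizations is that of [set_type]. *)
Definition congruent (x y : realizations) : bool :=
  `[< exists2 f, Cent k f & forall i, (val y : placement) i
                                      = f ((val x : placement) i) >].

Lemma congruent_refl : reflexive congruent.
Proof. by move=> x; apply/asboolP; exists id => //; exact: Cent_id. Qed.

Lemma congruent_sym : symmetric congruent.
Proof.
suff sub x y : congruent x y -> congruent y x.
  by move=> x y; apply/idP/idP; exact: sub.
move=> /asboolP[f Cf xy]; apply/asboolP.
have [[[h fK hK] _] _] := Cf.
by exists h; [exact: Cent_inv Cf fK hK | move=> i; rewrite xy fK].
Qed.

Lemma congruent_trans : transitive congruent.
Proof.
move=> y x z /asboolP[f Cf xy] /asboolP[h Ch yz]; apply/asboolP.
by exists (h \o f); [exact: Cent_comp | move=> i; rewrite yz xy].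
Qed.

Canonical congruent_equiv : equiv_rel realizations :=
  EquivRel congruent congruent_refl congruent_sym congruent_trans.

Definition config_space : Type :=
  quotient_topology {eq_quot congruent_equiv}.
HB.instance Definition _ := Topological.on config_space.

Definition rigid (p : placement) : Prop :=
  exists2 x : realizations, val x = p &
    isolated [set: config_space] (\pi_config_space x).

End Frameworks.

Section MinimalRigidity.
Variables (R : realType) (k : nat) (H : sym_graph k).

Definition minimally_rigid (len : edge H -> R) (p : placement R H) : Prop :=
  rigid (actV H) len p /\
  forall e : edge H,
    let G' := del_edges (orbit (actE H) [set: 'Z_k]%SET e) in
    ~ @rigid R k G' (actV H) (fun e' : edge G' => len (val e')) p.

Definition induced_length (p : placement R H) (e : edge H) : R :=
  edist (p (edge_src e)) (p (edge_dst e)).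

Variables (C : colored_graph k) (q : colored_quotient H C).

(* The g such that x = i_g, where i is the orbit of x; it exists and is unique
   as the action is free. *)
Definition vertex_offset (x : vertex H) : 'Z_k :=
  odflt 0 [pick g : 'Z_k | lift_vertex q (projV q x) g == x].

Definition symmetric_placement (p : vertex C -> 'cV[R]_2) : placement R H :=
  fun x => rot (vertex_offset x) (p (projV q x)).

End MinimalRigidity.

Section AlgebraicSets.
Variables (R : realType) (V : finType).

Definition coordinates (p : V -> 'cV[R]_2) : 'I_#|{: V * 'I_2}| -> R :=
  fun a => p (enum_val a).1 (enum_val a).2 0.

Definition algebraic_subset (Z : set (V -> 'cV[R]_2)) : Prop :=
  exists s : seq (mpoly #|{: V * 'I_2}| R),
    Z = [set p : V -> _ |
      forall f : mpoly _ R, f \in s -> meval (coordinates p) f = 0].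

Definition proper_algebraic_subset (Z : set (V -> 'cV[R]_2)) : Prop :=
  algebraic_subset Z /\ Z <> setT.

End AlgebraicSets.

(* Main.v *)
(* Write x for the row of all coordinates of p. Each edge e of the quotient
   gives a linear map D_e sending x to the edge vector, and the length
   constraint is |x D_e|^2 = const, with gradient x D_e D_e^T up to a factor 2:
   the rigidity row. Everything reduces to the rank of the rigidity rows.

   Rigidity and rank. For quadratic constraints, two points y and z with the
   same lengths satisfy that z - y is killed by the rigidity rows at y + z. If
   the corank is 1, the only such vectors are multiples of the rotation field
   at y + z, and z is a rotated copy of y (Cayley transform). If the corank is
   at least 2, some inner product <p_i, p_j> has a gradient outside the row
   space; a contraction argument produces points near p with the same lengths
   on a basis of the rows and another value of <p_i, p_j>, and the other lengths
   are then preserved because the rank is maximal.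

   Rank and cone-Laman. Independent rows satisfy the count since, component by
   component, they are orthogonal to the rotation field, and also to two twisted
   translations when the colors have a potential. Conversely, following the
   proof of Laman's theorem by direction networks, replace x D_e by a free
   direction d_e. By Rado's theorem on independent transversals, the count makes
   the rows d_e D_e^T independent for suitable d_e even after doubling any one
   edge. For generic d_e the kernel of these rows is then a line, spanned by
   some x with x D_e <> 0 for all e and x D_e orthogonal to d_e, so that up to
   a quarter turn the d_e D_e^T are the rigidity rows at x. *)

From HB Require Import structures.
From mathcomp Require Import -(notations) mpoly.
From mathcomp Require Import all_boot all_order all_algebra all_fingroup.
From mathcomp Require Import lra zify.
From mathcomp Require Import generic_quotient.
From mathcomp Require Import all_classical all_reals all_analysis.
Require Import Defs.

Set Implicit Arguments.
Unset Strict Implicit.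
Unset Printing Implicit Defensive.

Import Order.TTheory GRing.Theory Num.Theory.
Import numFieldNormedType.Exports.

Local Open Scope classical_set_scope.
Local Open Scope ring_scope.

(** * Independent transversals *)

Section Rado.
Variables (F : fieldType) (N : nat) (I J : finType) (S : I -> J -> 'rV[F]_N).

Definition option_span (A : {set I}) (X : {ffun I -> {set J}}) : 'M[F]_N :=
  (\sum_(i in A) \sum_(j in X i) <<S i j>>)%MS.

Lemma option_spanS (A B : {set I}) (X Y : {ffun I -> {set J}}) :
  A \subset B -> {in A, forall i, X i \subset Y i} ->
  (option_span A X <= option_span B Y)%MS.
Proof.
move=> /fintype.subsetP AB XY; apply/sumsmx_subP => i iA; apply/sumsmx_subP => j jX.
apply: (sumsmx_sup i); first exact: AB.
by apply: (sumsmx_sup j) => //; exact: (fintype.subsetP (XY i iA)).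
Qed.

(* As long as some index keeps two options, one of them can be dropped: if
   dropping either violates the condition, on A and on B, then submodularity
   of the rank violates it on A :|: B or on A :&: B minus that index. *)
Lemma rado_options (X : {ffun I -> {set J}}) :
  (forall A : {set I}, #|A| <= \rank (option_span A X))%N ->
  exists c : I -> J, (#|I| <= \rank (\sum_i <<S i (c i)>>)%MS)%N.
Proof.
have [n] := ubnP (\sum_i #|X i|); elim: n X => // n IHn X sX hX.
case: (altP (@existsP _ (fun i => 1 < #|X i|)%N)) => [[i Xi]|]; last first.
  rewrite negb_exists => /forallP X1.
  have X0 i : exists j, j \in X i.
    apply/finset.set0Pn; apply: contraTneq (hX [set i]%SET) => Xi0.
    by rewrite /option_span big_set1 Xi0 big_set0 mxrank0 cards1.
  exists (fun i => xchoose (X0 i)); rewrite -cardsT (leq_trans (hX _)) //.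
  apply/mxrankS/sumsmx_subP => i _; apply/sumsmx_subP => j jX.
  apply: (sumsmx_sup i) => //.
  suff -> : xchoose (X0 i) = j by [].
  have /cards1P[a Xa] : #|X i| == 1%N.
    by rewrite eqn_leq leqNgt X1 card_gt0; apply/finset.set0Pn; exact: X0.
  have := xchooseP (X0 i); move: (xchoose _) jX => b; rewrite Xa !inE.
  by move=> /eqP-> /eqP.
pose drop x : {ffun I -> {set J}} :=
  [ffun l => if l == i then X i :\ x else X l].
have drop_other x l : l != i -> drop x l = X l.
  by move=> li; rewrite ffunE (negPf li).
have drop_sum x : x \in X i -> (\sum_l #|drop x l| < n)%N.
  move=> xX; rewrite -ltnS (leq_trans _ sX) // ltnS.
  rewrite [X in (X < _)%N](bigD1 i) // [X in (_ < X)%N](bigD1 i) //=.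
  rewrite ffunE eqxx [#|X i|](cardsD1 x) xX /= -addSn add1n leq_add //.
  by apply: leq_sum => l li; rewrite drop_other.
(* Only the option set of [i] shrinks, so a violated condition concerns a set containing [i]; if
   none is violated, the induction hypothesis applies. *)
have violated x : (exists c : I -> J,
     (#|I| <= \rank (\sum_i <<S i (c i)>>)%MS)%N) \/ (x \in X i ->
   exists A : {set I}, (\rank (option_span A (drop x)) < #|A|)%N /\ i \in A).
  case: (boolP [forall A : {set I}, (#|A| <= \rank (option_span A (drop x)))%N]).
    move=> /forallP ok; case: (boolP (x \in X i)) => xX; last by right.
    by left; apply: IHn ok; exact: drop_sum.
  rewrite negb_forall => /existsP[A]; rewrite -ltnNge => bad; right => xX.
  exists A; split=> //; apply: contraLR bad => iA; rewrite -leqNgt.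
  apply: leq_trans (hX A) (mxrankS _); apply: option_spanS => // l lA.
  by rewrite drop_other //; apply: contraNneq iA => <-.
have /card_gt1P[x [y [xX yX xy]]] := Xi.
have [//|/(_ xX)[A [badA iA]]] := violated x.
have [//|/(_ yX)[B [badB iB]]] := violated y.
have := mxrank_sum_cap (option_span A (drop x)) (option_span B (drop y)).
(* As [x] and [y] differ, each option of [i] survives in at least one of the two families. *)
have sU : (option_span (A :|: B) X <=
    option_span A (drop x) + option_span B (drop y))%MS.
  apply/sumsmx_subP => l; rewrite inE => lAB; apply/sumsmx_subP => j jX.
  have [li|li] := eqVneq l i.
    rewrite {l}li in lAB jX *; have [jx|jx] := eqVneq j x.
      apply: submx_trans (addsmxSr _ _); apply: (sumsmx_sup i) => //.
      by apply: (sumsmx_sup j) => //; rewrite ffunE eqxx !inE jX andbT jx.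
    apply: submx_trans (addsmxSl _ _); apply: (sumsmx_sup i) => //.
    by apply: (sumsmx_sup j) => //; rewrite ffunE eqxx !inE jX andbT jx.
  case/orP: lAB => lAB.
    apply: submx_trans (addsmxSl _ _); apply: (sumsmx_sup l) => //.
    by apply: (sumsmx_sup j) => //; rewrite drop_other.
  apply: submx_trans (addsmxSr _ _); apply: (sumsmx_sup l) => //.
  by apply: (sumsmx_sup j) => //; rewrite drop_other.
have sI : (option_span (A :&: B :\ i) X <=
    option_span A (drop x) :&: option_span B (drop y))%MS.
  rewrite sub_capmx; apply/andP; split; apply: option_spanS.
  - by apply/fintype.subsetP => l; rewrite !inE => /and3P[].
  - by move=> l; rewrite !inE => /and3P[li _ _]; rewrite drop_other.
  - by apply/fintype.subsetP => l; rewrite !inE => /and3P[].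
  - by move=> l; rewrite !inE => /and3P[li _ _]; rewrite drop_other.
(* The two violations lose 2 in total, while removing [i] from the intersection costs only 1. *)
have := leq_trans (hX _) (mxrankS sU); have := leq_trans (hX _) (mxrankS sI).
have := cardsUI A B; rewrite [#|A :&: B|](cardsD1 i) inE iA iB /=.
by move: badA badB; clear; lia.
Qed.

Theorem rado :
  (forall A : {set I}, #|A| <= \rank (\sum_(i in A) \sum_j <<S i j>>)%MS)%N ->
  exists c : I -> J, (#|I| <= \rank (\sum_i <<S i (c i)>>)%MS)%N.
Proof.
move=> h; apply: (@rado_options [ffun _ => [set: J]%SET]) => A.
rewrite (leq_trans (h A)) //; apply/mxrankS/sumsmx_subP => i iA.
apply/sumsmx_subP => j _; apply: (sumsmx_sup i) => //.
by apply: (sumsmx_sup j); rewrite // ffunE inE.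
Qed.

End Rado.

(** * Nonroots of functions that are polynomial along lines *)

Section LinePolynomials.
Variables (R : numFieldType) (W : lmodType R).

(** A weak form of polynomiality that needs no coordinates on [W] and suffices to combine
    nonroots. *)
Definition line_poly (f : W -> R) :=
  forall x v, exists q : {poly R}, forall t, f (x + t *: v) = q.[t].

(** In characteristic zero the natural numbers below [size q] are distinct, hence too many to be all
    roots. *)
Lemma poly_nonroot (q : {poly R}) : q != 0 -> exists t, q.[t] != 0.
Proof.
move=> q0; apply/not_existsP => all0.
suff : (size [seq i%:R : R | i <- iota 0 (size q)] < size q)%N.
  by rewrite size_map size_iota ltnn.
apply: max_poly_roots => //.
  by apply/allP => t _; apply/rootP/eqP/negPn/negP; exact: all0.
by rewrite map_inj_uniq ?iota_uniq // => i j /eqP; rewrite eqr_nat => /eqP.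
Qed.

(** On the line from a common nonroot of the functions already treated to a nonroot of the next one,
    each of them restricts to a nonzero polynomial, and so the product has a nonroot there. *)
Lemma common_nonroot (I : finType) (f : I -> W -> R) :
  (forall i, line_poly (f i)) -> (forall i, exists x, f i x != 0) ->
  exists x, forall i, f i x != 0.
Proof.
move=> fp f0; suff [x hx] : exists x, forall i, i \in enum I -> f i x != 0.
  by exists x => i; apply: hx; rewrite mem_enum.
elim: (enum I) => [|i s [x hx]]; first by exists 0.
have [y hy] := f0 i.
pose q j := xget 0 [set q : {poly R} | forall t, f j (x + t *: (y - x)) = q.[t]].
have qE j t : f j (x + t *: (y - x)) = (q j).[t].
  have [p hp] := fp j x (y - x).
  exact: (@xgetPex _ 0 [set q : {poly R} |
    forall t, f j (x + t *: (y - x)) = q.[t]] (ex_intro _ p hp)).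
have [t] : exists t, (q i * \prod_(j <- s) q j).[t] != 0.
  apply: poly_nonroot; rewrite mulf_neq0 //.
    apply: contraNneq hy => q0; have := qE i 1.
    by rewrite q0 horner0 scale1r addrC subrK => ->.
  rewrite prodf_seq_neq0; apply/allP => j js /=; apply: contraNneq (hx j js) => q0.
  by have := qE j 0; rewrite q0 horner0 scale0r addr0 => ->.
rewrite hornerM mulf_eq0 negb_or horner_prod prodf_seq_neq0.
move=> /andP[qi /allP qs]; exists (x + t *: (y - x)) => j.
by rewrite inE qE => /orP[/eqP->//|/qs].
Qed.

Lemma det_line_poly n (A : W -> 'M[R]_n) :
  (forall x v t, A (x + t *: v) = A x + t *: A v) -> line_poly (fun x => \det (A x)).
Proof.
move=> Alin x v; exists (\det (map_mx polyC (A x) + 'X *: map_mx polyC (A v))) => t.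
rewrite Alin -[RHS]/(horner_eval t _) -det_map_mx; congr (\det _).
by apply/matrixP => i j; rewrite !mxE /= /horner_eval !hornerE.
Qed.

End LinePolynomials.

(** * Spans of families of rows *)

Section Spans.
Variables (F : fieldType) (N m : nat) (I : finType) (w : I -> 'M[F]_(m, N)).
Implicit Types A B : {set I}.

(** Blocks of [m] rows are allowed: [m = 1] serves for rigidity rows, [m = 2] for transposed edge
    and vertex maps. *)
Definition span_of A : 'M[F]_N := (\sum_(i in A) <<w i>>)%MS.

Lemma mem_span_of A i : i \in A -> (w i <= span_of A)%MS.
Proof. by move=> iA; rewrite /span_of (sumsmx_sup i) // genmxE. Qed.

Lemma span_ofP A p (M : 'M[F]_(p, N)) :
  (forall i, i \in A -> (w i <= M)%MS) -> (span_of A <= M)%MS.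
Proof. by move=> AM; apply/sumsmx_subP => i iA; rewrite genmxE AM. Qed.

Lemma span_ofS A B : A \subset B -> (span_of A <= span_of B)%MS.
Proof.
by move=> /fintype.subsetP AB; apply: span_ofP => i /AB; exact: mem_span_of.
Qed.

Lemma span_of_ker A (x : 'rV[F]_N) :
  (span_of A <= kermx x^T)%MS <-> forall i, i \in A -> w i *m x^T = 0.
Proof.
split=> [Ax i iA|Ax]; last by apply: span_ofP => i /Ax /eqP; rewrite -sub_kermx.
by apply/eqP; rewrite -sub_kermx; exact: submx_trans (mem_span_of iA) Ax.
Qed.

Lemma span_ofU A B : (span_of (A :|: B) <= span_of A + span_of B)%MS.
Proof.
apply: span_ofP => i; rewrite inE => /orP[] iA.
  exact: submx_trans (mem_span_of iA) (addsmxSl _ _).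
exact: submx_trans (mem_span_of iA) (addsmxSr _ _).
Qed.

Lemma rank_span_of A : (\rank (span_of A) <= m * #|A|)%N.
Proof.
rewrite mulnC -sum_nat_const /span_of.
elim/big_rec2: _ => [|i M b _ ih]; first by rewrite mxrank0.
rewrite (leq_trans (mxrank_adds_leqif _ _)) // leq_add // mxrank_gen.
exact: rank_leq_row.
Qed.

End Spans.

Section Independence.
Variables (F : fieldType) (N : nat) (I : finType) (w : I -> 'rV[F]_N).
Implicit Types A B : {set I}.

(** The reverse inequality always holds, so this is linear independence of the family of rows
    indexed by [A]. *)
Definition independent A := (#|A| <= \rank (span_of w A))%N.

Lemma independent_rank A : independent A -> \rank (span_of w A) = #|A|.
Proof. 
move=> h; apply/eqP; rewrite eqn_leq; apply/andP; split=> //.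
by rewrite -[#|A|]mul1n rank_span_of.
Qed.

Lemma independentS A B : A \subset B -> independent B -> independent A.
Proof.
move=> AB iB; have BE : B = A :|: (B :\: A).
  by rewrite -{1}(finset.setID B A) (finset.setIidPr AB).
have := leq_trans (mxrankS (span_ofU w A (B :\: A))) (mxrank_adds_leqif _ _).
rewrite -BE (independent_rank iB) => h.
have := rank_span_of w (B :\: A); have := cardsID A B.
rewrite (finset.setIidPr AB) mul1n /independent; move: h; clear; lia.
Qed.

Lemma independent_add A i : independent A -> ~ (w i <= span_of w A)%MS ->
  independent (i |: A).
Proof.
move=> iA ni; have iNA : i \notin A.
  by apply/negP => /(mem_span_of w).
rewrite /independent cardsU1 iNA add1n -(independent_rank iA).
have sA : (span_of w A <= span_of w (i |: A))%MS by rewrite span_ofS // finset.subsetUr.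
rewrite ltn_neqAle mxrankS // andbT.
apply: contra_notN ni; rewrite (mxrank_leqif_sup sA); apply: submx_trans.
by rewrite mem_span_of // finset.setU11.
Qed.

(** A maximal independent subset spans, because a row outside its span could be added to it. *)
Lemma basis_exists A :
  exists B : {set I}, [/\ B \subset A, independent B & (span_of w A <= span_of w B)%MS].
Proof.
have [|B /maxsetP[/andP[BA iB] maxB]] :=
  @ex_maxset _ [pred B : {set I} | (B \subset A) && (#|B| <= \rank (span_of w B))%N].
  by exists finset.set0; rewrite /= finset.sub0set cards0.
exists B; split=> //; apply: span_ofP => i iA; apply/negPn/negP => ni.
have niB : i \notin B by apply: contra ni => /(mem_span_of w).
have iBA : i |: B \subset A by rewrite finset.subUset finset.sub1set iA.
suff : i |: B = B by move=> h; move: niB; rewrite -h finset.setU11.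
apply: maxB; last exact: finset.subsetUr.
by rewrite /= iBA; apply: independent_add => //; apply/negP.
Qed.

End Independence.

Lemma full_rank_ker0 (F : fieldType) m N (M : 'M[F]_(m, N)) (x : 'rV[F]_N) :
  (N <= \rank M)%N -> x *m M^T = 0 -> x = 0.
Proof.
move=> rM xM; have : M *m x^T = 0 by rewrite -[LHS]trmxK trmx_mul trmxK xM trmx0.
move=> /eqP; rewrite -sub_kermx => /mxrankS; rewrite mxrank_ker => rMx.
apply/eqP; rewrite -mxrank_eq0 -mxrank_tr; move: (rank_leq_row x^T); lia.
Qed.

Lemma corank1_ker (F : fieldType) N m (M : 'M[F]_(m, N)) (v w : 'rV[F]_N) :
  (N <= (\rank M).+1)%N -> v != 0 -> M *m v^T = 0 -> M *m w^T = 0 ->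
  exists t, w = t *: v.
Proof.
move=> rM v0 Mv Mw; apply/sub_rVP.
have kv : (v <= kermx M^T)%MS.
  by rewrite sub_kermx -[v]trmxK -trmx_mul Mv trmx0.
have kw : (w <= kermx M^T)%MS.
  by rewrite sub_kermx -[w]trmxK -trmx_mul Mw trmx0.
apply: submx_trans kw _; rewrite -(geq_leqif (mxrank_leqif_sup kv)).
by rewrite mxrank_ker mxrank_tr rank_rV v0; lia.
Qed.

Section RealRows.
Variable F : realFieldType.

Lemma row_sqr_eq0 N (x : 'rV[F]_N) : x *m x^T = 0 -> x = 0.
Proof.
move=> /matrixP/(_ 0 0); rewrite !mxE => /eqP.
rewrite psumr_eq0 => [/allP h|i _]; last by rewrite mxE -expr2 sqr_ge0.
apply/rowP => i; have := h i (mem_index_enum _).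
by rewrite !mxE -expr2 sqrf_eq0 => /eqP.
Qed.

(** Over an ordered field a row common to two orthogonal spaces is orthogonal to itself, hence zero;
    so their sum is direct. *)
Lemma rank_orthogonal N m p q (A : 'M[F]_(m, N)) (B : 'M[F]_(p, N)) (C : 'M[F]_(q, N)) :
  A *m B^T = 0 -> (A <= C)%MS -> (B <= C)%MS -> (\rank A + \rank B <= \rank C)%N.
Proof.
move=> AB sA sB; rewrite -mxrank_disjoint_sum ?mxrankS ?addsmx_sub ?sA //.
apply/eqP; rewrite -submx0; apply/row_subP => i.
have := row_sub i (A :&: B)%MS; rewrite sub_capmx.
move: (row i _) => x /andP[xA /submxP[z xz]].
rewrite submx0; apply/eqP/row_sqr_eq0; rewrite {2}xz trmx_mul mulmxA.
by move: xA => /submxP[y ->]; rewrite -(mulmxA y) AB mulmx0 mul0mx.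
Qed.

End RealRows.

(** * Rigidity rows *)

Lemma sum2E (V : nmodType) (f : 'I_2 -> V) : \sum_i f i = f 0 + f 1.
Proof.
rewrite !big_ord_recl big_ord0 addr0; congr (_ + f _).
exact/val_inj.
Qed.

Lemma ord2P (P : 'I_2 -> Prop) : P 0 -> P 1 -> forall i, P i.
Proof.
by move=> P0 P1 [[|[|//]] h]; [have -> : Ordinal h = 0|have -> : Ordinal h = 1];
  do ?exact/val_inj.
Qed.

Lemma trmx11 (F : nzRingType) (M : 'M[F]_1) : M^T = M.
Proof. by apply/matrixP => i j; rewrite !ord1 mxE. Qed.

(** Difference of squares, the cross terms cancelling by symmetry. It makes equality of lengths an
    exact linear condition at the midpoint, not only a first-order one. *)
Lemma quadratic_diff (F : comNzRingType) N (S : 'M[F]_N) (y z : 'rV_N) :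
  S^T = S ->
  z *m S *m z^T - y *m S *m y^T = (y + z) *m S *m (z - y)^T.
Proof.
move=> sS; have sym : z *m S *m y^T = y *m S *m z^T.
  by rewrite -[LHS]trmx11 !trmx_mul trmxK sS mulmxA.
rewrite linearB /= mulmxBr !mulmxDl sym.
by rewrite [X in _ = X - _]addrC [X in _ = _ - X]addrC addrKA.
Qed.

Section QuarterTurn.
Variable F : realFieldType.

Definition quarter_turn : 'M[F]_2 := \matrix_(i, j)
  (if i == j then 0 else if i == 0 then 1 else -1).

Lemma quarter_turnE (u : 'rV[F]_2) :
  ((u *m quarter_turn) 0 0 = - u 0 1) * ((u *m quarter_turn) 0 1 = u 0 0).
Proof. by split; rewrite !mxE sum2E !mxE /=; lra. Qed.

Lemma trmx_quarter_turn : quarter_turn^T = - quarter_turn.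
Proof.
by apply/matrixP; apply: ord2P; apply: ord2P; rewrite !mxE /= ?oppr0 ?opprK.
Qed.

Lemma quarter_turn_sqr : quarter_turn *m quarter_turn = - 1%:M.
Proof.
by apply/matrixP; apply: ord2P; apply: ord2P; rewrite !mxE sum2E !mxE /=; lra.
Qed.

Lemma quarter_turn_perp (u : 'rV[F]_2) : u *m quarter_turn *m u^T = 0.
Proof.
apply/matrixP => i j; rewrite !ord1 !mxE sum2E !quarter_turnE !mxE; lra.
Qed.

Lemma perp2 (u v : 'rV[F]_2) : u != 0 -> v *m u^T = 0 ->
  exists c, v = c *: (u *m quarter_turn).
Proof.
move=> u0 /matrixP/(_ 0 0); rewrite !mxE sum2E !mxE => uv.
set s := u 0 0 ^+ 2 + u 0 1 ^+ 2.
have s0 : s != 0.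
  apply: contraNneq u0 => /eqP; rewrite paddr_eq0 ?sqr_ge0 // !sqrf_eq0.
  move=> /andP[/eqP a /eqP b].
  by apply/eqP/rowP; apply: ord2P; rewrite mxE.
(* The coefficient is the inner product of [v] with the turned [u], over the squared length of
   [u]. *)
exists ((v 0 1 * u 0 0 - v 0 0 * u 0 1) / s).
apply/rowP; apply: ord2P; rewrite mxE quarter_turnE; apply: (mulfI s0).
  rewrite mulrA mulrCA divff // mulr1 /s.
  by move/(congr1 ( *%R (u 0 0))): uv; lra.
rewrite mulrA mulrCA divff // mulr1 /s.
by move/(congr1 ( *%R (u 0 1))): uv; lra.
Qed.

End QuarterTurn.

Section RigidityRows.
Variables (F : realFieldType) (N : nat) (E : finType) (D : E -> 'M[F]_(N, 2)).
Implicit Types (x y z : 'rV[F]_N) (A : {set E}) (e : E).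

Definition sqlen e x : F := (x *m (D e *m (D e)^T) *m x^T) 0 0.

(* Half the gradient of [sqlen e] at x. *)
Definition rigidity_row x e : 'rV[F]_N := x *m (D e *m (D e)^T).

Lemma sqlenB e y z :
  sqlen e z - sqlen e y = (rigidity_row (y + z) e *m (z - y)^T) 0 0.
Proof. 
rewrite /rigidity_row -quadratic_diff; last by rewrite trmx_mul trmxK.
by rewrite [RHS]mxE [X in _ = _ + X]mxE.
Qed.

Lemma sqlen_eqP e y z :
  sqlen e z = sqlen e y <-> rigidity_row (y + z) e *m (z - y)^T = 0.
Proof.
split=> [/eqP|h]; last by apply/eqP; rewrite -subr_eq0 sqlenB h mxE.
by rewrite -subr_eq0 sqlenB => /eqP h; apply/matrixP => i j; rewrite !ord1 h mxE.
Qed.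

(** [J] stands for a quarter turn of the whole configuration, so that [x *m J] is the infinitesimal
    rotation at [x]. *)
Variable J : 'M[F]_N.
Hypotheses (J2 : J *m J = - 1%:M) (JD : forall e, J *m D e = D e *m quarter_turn F).

(** The rotation field changes each edge vector by its quarter turn, which is perpendicular to
    it. *)
Lemma rigidity_row_turn x e : rigidity_row x e *m (x *m J)^T = 0.
Proof.
rewrite /rigidity_row trmx_mul !mulmxA -(mulmxA _ _ J^T) -trmx_mul JD trmx_mul.
rewrite trmx_quarter_turn mulNmx mulmxN mulNmx !mulmxA -mulmxA -trmx_mul.
by rewrite quarter_turn_perp oppr0.
Qed.

Lemma turn_eq0 x : (x *m J == 0) = (x == 0).
Proof.
apply/eqP/eqP => [h|->]; last exact: mul0mx.
by apply: oppr_inj; rewrite oppr0 -[x]mulmx1 -mulmxN -J2 mulmxA h mul0mx.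
Qed.

(* The difference of two close realizations with the same edge lengths is an
   infinitesimal motion of their midpoint. *)
Lemma local_rigidity A y z : (2 <= N)%N ->
  (N <= (\rank (span_of (rigidity_row (y + z)) A)).+1)%N ->
  (forall e, e \in A -> sqlen e z = sqlen e y) ->
  exists t, z - y = t *: ((y + z) *m J).
Proof.
move=> N2 rA hA; apply: (@corank1_ker _ _ _ _ _ _ rA).
(* If [y + z] were zero, all rows there would vanish and the corank would be [N], which is at least
   2. *)
- rewrite turn_eq0; apply: contraTneq rA => ->; rewrite -ltnNge.
  suff -> : span_of (rigidity_row 0) A = 0 by rewrite mxrank0.
  apply/eqP; rewrite -submx0; apply: span_ofP => e _.
  by rewrite /rigidity_row mul0mx sub0mx.
- apply/eqP; rewrite -sub_kermx; apply/span_of_ker => e _.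
  exact: rigidity_row_turn.
- by apply/eqP; rewrite -sub_kermx; apply/span_of_ker => e /hA /sqlen_eqP.
Qed.

(* The doubled copy of e0 is [None]; its direction is [d (inr e0)]. *)
Let doubled_row (e0 : E) (i : option E) (d : {ffun E + E -> 'rV[F]_2}) : 'rV[F]_N :=
  (if i is Some e then d (inl e) else d (inr e0)) *m (D (odflt e0 i))^T.

Let doubled_mx (hN : N = #|{: option E}|) e0 d : 'M[F]_N :=
  \matrix_b doubled_row e0 (enum_val (cast_ord hN b)) d.

(** Rado's theorem picks a coordinate direction for every edge and for the extra copy of [e0]; the
    strict inequality pays for that copy. *)
Lemma doubled_mx_nonroot (hN : N = #|{: option E}|) e0 :
  (forall A : {set E}, A != finset.set0 ->
     #|A| < \rank (span_of (fun e => (D e)^T) A))%N ->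
  exists d, \det (doubled_mx hN e0 d) != 0.
Proof.
move=> hA; have [|c hc] := @rado F N (option E) 'I_2
    (fun i l => row l (D (odflt e0 i))^T).
  move=> B; have [->|B0] := eqVneq B finset.set0; first by rewrite cards0.
  pose B' := (odflt e0 @: B)%SET.
  have B'0 : B' != finset.set0 by rewrite imset_eq0.
  have leB : (#|B| <= #|B'|.+1)%N.
    rewrite (cardsD1 None) -add1n leq_add ?leq_b1 //.
    rewrite -(@card_in_imset _ _ (odflt e0)) ?subset_leq_card //.
      apply/imsetS/fintype.subsetP => i; exact: (fintype.subsetP (finset.subD1set _ _)).
    by move=> [i|] [j|]; rewrite !inE //= => _ _ ->.
  apply: leq_trans leB (leq_trans (hA _ B'0) (mxrankS _)).
  apply: span_ofP => _ /imsetP[i iB ->]; apply/row_subP => l.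
  apply: (sumsmx_sup i) => //; apply: (sumsmx_sup l) => //.
  by rewrite genmxE.
exists [ffun s => match s with inl e => delta_mx 0 (c (Some e))
                             | inr _ => delta_mx 0 (c None) end].
set d := finfun _; rewrite -unitfE -unitmxE -row_free_unit.
suff : (\rank (\sum_i <<row (c i) (D (odflt e0 i))^T>>)%MS <= \rank (doubled_mx hN e0 d))%N.
  by move=> /(leq_trans hc); rewrite -hN -row_leq_rank.
apply: mxrankS; apply/sumsmx_subP => i _; rewrite genmxE.
have -> : row (c i) (D (odflt e0 i))^T =
    row (cast_ord (esym hN) (enum_rank i)) (doubled_mx hN e0 d).
  rewrite rowK cast_ordKV enum_rankK /doubled_row /d; case: i => [e|];
  by rewrite ffunE -rowE.
exact: row_sub.
Qed.

Theorem independent_point_exists : N = #|E|.+1 ->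
  (forall A : {set E}, A != finset.set0 ->
     #|A| < \rank (span_of (fun e => (D e)^T) A))%N ->
  exists x, independent (rigidity_row x) [set: E]%SET.
Proof.
move=> hN hA.
have hN' : N = #|{: option E}| by rewrite card_option.
(* A single [d] that is good for every choice of the doubled edge. *)
have [d hd] : exists d, forall e0, \det (doubled_mx hN' e0 d) != 0.
  apply: common_nonroot => e0; last exact: doubled_mx_nonroot.
  apply: det_line_poly => d d' t; apply/row_matrixP => b.
  rewrite linearD linearZ /= !rowK /doubled_row scalemxAl -mulmxDl.
  by case: (enum_val _) => [e|] /=; rewrite !ffunE.
have dN e0 : (N <= \rank (doubled_mx hN' e0 d))%N.
  by rewrite row_leq_rank row_free_unit unitmxE unitfE hd.
pose s e := d (inl e) *m (D e)^T.
have doubled_sub e0 : (doubled_mx hN' e0 d <=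
    span_of s [set: E]%SET + d (inr e0) *m (D e0)^T)%MS.
  apply/row_subP => b; rewrite rowK; case: (enum_val _) => [e|] /=.
    by apply: submx_trans (addsmxSl _ _); apply: (@mem_span_of _ _ _ _ s); rewrite inE.
  exact: addsmxSr.
have is_ : independent s [set: E]%SET.
  rewrite /independent; have [->//|/finset.set0Pn[e0 _]] := eqVneq [set: E]%SET finset.set0.
    by rewrite cards0.
  have := leq_trans (dN e0) (leq_trans (mxrankS (doubled_sub e0)) (mxrank_adds_leqif _ _)).
  rewrite cardsT => h; have := rank_leq_row (d (inr e0) *m (D e0)^T).
  by move: h hN; clear; lia.
(* There are only [N - 1] rows [s e], so they have a common nonzero orthogonal vector. *)
have [x [x0 xs]] : exists x, x != 0 /\ forall e, s e *m x^T = 0.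
  have : kermx (span_of s [set: E]%SET)^T != 0.
    rewrite -mxrank_eq0 mxrank_ker mxrank_tr (independent_rank is_) cardsT hN.
    by rewrite subSnn.
  move=> /rowV0Pn[x xk x0]; exists x; split=> // e.
  have xs : span_of s [set: E]%SET *m x^T = 0.
    by move: xk; rewrite sub_kermx => /eqP xk; rewrite -[LHS]trmxK trmx_mul trmxK xk trmx0.
  move/eqP: xs; rewrite -sub_kermx => /span_of_ker; apply.
  by rewrite inE.
(* Otherwise [x] would also be orthogonal to the extra copy of [e], hence to a full-rank family. *)
have xD e : x *m D e != 0.
  apply: contra_neq x0 => xDe; apply: (full_rank_ker0 (dN e)).
  rewrite -[LHS]trmxK trmx_mul trmxK -[RHS]trmx0; congr trmx; apply/eqP.
  rewrite -sub_kermx; apply: submx_trans (doubled_sub e) _.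
  rewrite addsmx_sub; apply/andP; split; first by apply/span_of_ker => f _.
  by rewrite sub_kermx -mulmxA -trmx_mul xDe trmx0 mulmx0.
exists x; rewrite /independent; apply: leq_trans is_ _.
apply: leq_trans (mxrankM_maxl _ J^T); apply/mxrankS/span_ofP => e _.
(* The direction of [e] is perpendicular to the edge vector, hence a multiple of its quarter turn;
   up to [J^T] this makes [s e] a multiple of the rigidity row. *)
have [|c dc] := perp2 (xD e) (v := d (inl e)).
  by rewrite trmx_mul mulmxA xs.
have -> : s e = - c *: (rigidity_row x e *m J^T).
  rewrite /s dc /rigidity_row -!mulmxA -trmx_mul JD trmx_mul trmx_quarter_turn.
  by rewrite mulNmx !mulmxN scaleNr scalerN opprK -scalemxAl !mulmxA.
by apply/scalemx_sub/submxMr/mem_span_of; rewrite inE.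
Qed.

End RigidityRows.

(** * Quadratic maps near a regular point *)

HB.instance Definition _ (R : realType) (m n : nat) := Complete.on 'M[R]_(m, n).

Lemma span_of_enum (F : fieldType) (N : nat) (I : finType) (w : I -> 'rV[F]_N)
    (B : {set I}) :
  (span_of w B :=: \matrix_(b < #|B|) w (enum_val b))%MS.
Proof.
apply/eqmxP/andP; split.
  apply: span_ofP => i iB; set G := \matrix_(_ < _) _.
  have -> : w i = row (enum_rank_in iB i) G by rewrite rowK enum_rankK_in.
  exact: row_sub.
by apply/row_subP => b; rewrite rowK; exact: mem_span_of (enum_valP b).
Qed.

Section MatrixAnalysis.
Variable R : realType.

Lemma mx_norm_le m n (x : 'M[R]_(m, n)) c :
  0 <= c -> (forall i j, `|x i j| <= c) -> `|x| <= c.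
Proof.
move=> c0 h; rewrite /Num.norm /= mx_normrE.
by apply: bigmax_le => // -[i j] _; exact: h.
Qed.

Lemma le_mx_norm m n (x : 'M[R]_(m, n)) i j : `|x i j| <= `|x|.
Proof.
rewrite {2}/Num.norm /= mx_normrE.
exact: (le_bigmax _ (fun ij : 'I_m * 'I_n => `|x ij.1 ij.2|) (i, j)).
Qed.

(** A crude operator bound for [K], both as a bilinear form and as a linear map, in the sup norm. *)
Definition abs_sum m n (K : 'M[R]_(m, n)) : R := \sum_j \sum_i `|K i j|.

Lemma abs_sum_ge0 m n (K : 'M[R]_(m, n)) : 0 <= abs_sum K.
Proof. by apply: sumr_ge0 => j _; apply: sumr_ge0. Qed.

Lemma bilinear_bound m n (K : 'M[R]_(m, n)) (u : 'rV_m) (v : 'rV_n) :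
  `|(u *m K *m v^T) 0 0| <= abs_sum K * (`|u| * `|v|).
Proof.
rewrite mxE (le_trans (ler_norm_sum _ _ _)) // /abs_sum mulr_suml.
apply: ler_sum => j _; rewrite !mxE normrM.
rewrite [`|u| * _]mulrC mulrA [leRHS]mulrAC; apply: ler_pM => //.
  rewrite mulr_suml (le_trans (ler_norm_sum _ _ _)) //.
  apply: ler_sum => i _; rewrite normrM mulrC ler_wpM2l //; exact: le_mx_norm.
exact: le_mx_norm.
Qed.

Lemma mulmx_bound m n (K : 'M[R]_(m, n)) (u : 'rV_m) :
  `|u *m K| <= abs_sum K * `|u|.
Proof.
apply: mx_norm_le => [|i j]; first by rewrite mulr_ge0 ?abs_sum_ge0.
rewrite ord1 mxE (le_trans (ler_norm_sum _ _ _)) //.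
rewrite (@le_trans _ _ (\sum_i `|K i j| * `|u|)) //.
  apply: ler_sum => i' _; rewrite normrM mulrC ler_wpM2l //; exact: le_mx_norm.
rewrite -mulr_suml ler_wpM2r // /abs_sum [leRHS](bigD1 j) //= lerDl.
by apply: sumr_ge0 => ? _; apply: sumr_ge0.
Qed.

Lemma continuous_det (T : topologicalType) n (A : T -> 'M[R]_n) :
  (forall i j, continuous (fun x => A x i j)) -> continuous (fun x => \det (A x)).
Proof.
move=> cA; apply: continuous_big => [|s _]; first exact: add_continuous.
move=> x; apply: cvgMl_tmp; move: x.
by apply: continuous_big => // ; exact: mul_continuous.
Qed.

Lemma continuous_mulmx_entry m n p (K : 'M[R]_(m, n)) i j :
  continuous (fun x : 'M[R]_(p, m) => (x *m K) i j).
Proof.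
have -> : (fun x : 'M[R]_(p, m) => (x *m K) i j) =
    (fun x : 'M[R]_(p, m) => \sum_l x i l * K l j).
  by apply/funext => x; rewrite mxE.
apply: continuous_big => [|l _]; first exact: add_continuous.
move=> x; apply: cvgMr_tmp; first exact: nbhs_filter.
exact: (@coord_continuous R p m i l x).
Qed.

(** A right inverse [L] of the rows at [x0] plays the part of a choice of columns: the determinant
    of the rows at [x] times [L] is 1 at [x0], and where it is nonzero the rows are independent. *)
Lemma independent_minor (N : nat) (E : finType) (Q : E -> 'M[R]_N)
    (B : {set E}) (x0 : 'rV[R]_N) :
  independent (fun e => x0 *m Q e) B ->
  exists K : 'I_#|B| -> 'M[R]_(N, #|B|),
    \det (\matrix_b (x0 *m K b)) != 0 /\
    forall x, \det (\matrix_b (x *m K b)) != 0 -> independent (fun e => x *m Q e) B.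
Proof.
move=> iB; pose G x : 'M[R]_(#|B|, N) := \matrix_b (x *m Q (enum_val b)).
have spanG x : (span_of (fun e => x *m Q e) B :=: G x)%MS by exact: span_of_enum.
have /row_freeP[L GL] : row_free (G x0) by rewrite -row_leq_rank -spanG.
have KE x : \matrix_b (x *m (Q (enum_val b) *m L)) = G x *m L.
  by apply/row_matrixP => b; rewrite row_mul !rowK mulmxA.
exists (fun b => Q (enum_val b) *m L); split=> [|x].
  by rewrite KE GL det1 oner_neq0.
rewrite KE => dx; rewrite /independent spanG.
have := mxrankM_maxl (G x) L; rewrite (@mxrank_unit _ _ (_ *m _)) //.
by rewrite unitmxE unitfE.
Qed.

Lemma independent_near (N : nat) (E : finType) (Q : E -> 'M[R]_N)
    (B : {set E}) (x0 : 'rV[R]_N) :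
  independent (fun e => x0 *m Q e) B ->
  \forall x \near x0, independent (fun e => x *m Q e) B.
Proof.
move=> /independent_minor[K [d0 dK]].
have cdet : continuous (fun x : 'rV[R]_N => \det (\matrix_b (x *m K b))).
  apply: continuous_det => b c; under eq_fun do rewrite mxE.
  exact: continuous_mulmx_entry.
by apply: filterS (cvgr_neq0 _ (cdet x0) d0) => x /dK.
Qed.

(* In the coordinates [w] with [x = w *m M] the equation to solve reads
   [w + q w = y] with [q] quadratic: a contraction near 0. *)
Lemma local_surjectivity (N s : nat) (Q : 'I_s -> 'M[R]_N) (p : 'rV[R]_N) :
  (forall b, (Q b)^T = Q b) -> row_free (\matrix_b (p *m Q b)) ->
  forall eps : R, 0 < eps -> exists2 delta : R, 0 < delta &
  forall y : 'rV[R]_s, `|y| < delta -> exists2 x : 'rV[R]_N, `|x| < eps &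
    forall b, ((p + x) *m Q b *m (p + x)^T) 0 0 = (p *m Q b *m p^T) 0 0 + y 0 b.
Proof.
move=> symQ /row_freeP[L GL] eps eps0.
(* The linear part of the quadratic map at [p] is twice [p *m Q b], whence the factor 1/2 on the
   inverse. *)
pose M := 2^-1 *: L^T.
pose K b := M *m Q b *m M^T.
pose q (w : 'rV[R]_s) : 'rV[R]_s := \row_b (w *m K b *m w^T) 0 0.
have qE w b : q w 0 b = (w *m K b *m w^T) 0 0 by rewrite mxE.
have symK b : (K b)^T = K b by rewrite /K !trmx_mul trmxK symQ mulmxA.
pose C := \sum_b abs_sum (K b).
have C0 : 0 <= C by apply: sumr_ge0 => b _; exact: abs_sum_ge0.
have CK b : abs_sum (K b) <= C.
  by rewrite /C (bigD1 b) //= lerDl sumr_ge0 // => ? _; exact: abs_sum_ge0.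
have q_lip w w' : `|q w - q w'| <= C * (`|w' + w| * `|w - w'|).
  apply: mx_norm_le => [|i b]; first by rewrite !mulr_ge0.
  have -> : (q w - q w') i b = ((w' + w) *m K b *m (w - w')^T) 0 0.
    by rewrite -quadratic_diff // ord1 [LHS]mxE [X in _ + X = _]mxE
      [RHS]mxE [X in _ = _ + X]mxE !qE.
  by rewrite (le_trans (bilinear_bound _ _ _)) // ler_wpM2r // mulr_ge0.
have M0 := abs_sum_ge0 M.
(* The first bound makes the map a contraction of ratio 1/2 on the ball of radius [rho], the second
   keeps [w *m M] below [eps]. The added 1's in the witnesses avoid dividing by zero. *)
have [rho rho0 [rhoC rhoM]] : exists2 rho : R, 0 < rho &
    (4 * C * rho <= 1 /\ abs_sum M * rho < eps).
  have C1 : 0 < 4 * C + 1 by lra.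
  have M1 : 0 < abs_sum M + 1 by lra.
  exists (Num.min (4 * C + 1)^-1 (eps / (abs_sum M + 1))).
    by rewrite lt_min invr_gt0 C1 divr_gt0.
  split.
    rewrite (@le_trans _ _ (4 * C * (4 * C + 1)^-1)) //.
      by rewrite ler_wpM2l ?ge_min ?lexx // mulr_ge0.
    by rewrite ler_pdivrMr //; lra.
  rewrite (@le_lt_trans _ _ (abs_sum M * (eps / (abs_sum M + 1)))) //.
    by rewrite ler_wpM2l ?ge_min ?lexx ?orbT.
  by rewrite mulrA ltr_pdivrMr //; nra.
exists (rho / 2); first by rewrite divr_gt0.
move=> y yrho.
pose U := closed_ball_ Num.norm (0 : 'rV[R]_s) rho.
pose f (w : 'rV[R]_s) := y - q w.
have UE w : U w <-> `|w| <= rho by rewrite /U /closed_ball_ /= sub0r normrN.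
have q0 : q 0 = 0 by apply/rowP => b; rewrite qE !mul0mx !mxE.
have fU : {homo f : w / U w >-> U w}.
  move=> w /UE wr; apply/UE; rewrite /f (le_trans (ler_normB _ _)) //.
  have := q_lip w 0; rewrite q0 add0r !subr0 => h.
  have : C * (`|w| * `|w|) <= C * rho * rho.
    by rewrite -mulrA ler_wpM2l // ler_pM.
  by move: h rhoC yrho; nra.
have half0 : 0 <= 2^-1 :> R by rewrite invr_ge0.
have [|||w /UE wU wE] := @banach_fixed_point R _ U (mkfun fU).
- exists (NngNum half0); split=> /=; first by rewrite invf_lt1 // ltr1n.
  move=> [u v] /= [/UE Uu /UE Uv]; rewrite /mkfun /f.
  rewrite opprB addrC addrA subrK.
  rewrite (le_trans (q_lip _ _)) // mulrA distrC ler_wpM2r //.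
  have := ler_normD u v; move: rhoC; nra.
- exact: closed_closed_ball_.
- by exists 0; apply/UE; rewrite normr0 ltW.
exists (w *m M).
  apply: le_lt_trans rhoM; rewrite (le_trans (mulmx_bound _ _)) //.
  by rewrite ler_wpM2l.
move=> b; apply/eqP; rewrite -subr_eq0 opprD addrA.
have -> : ((p + w *m M) *m Q b *m (p + w *m M)^T) 0 0 - (p *m Q b *m p^T) 0 0 =
     ((p + w *m M) *m Q b *m (p + w *m M)^T - p *m Q b *m p^T) 0 0.
  by rewrite [RHS]mxE [X in _ = _ + X]mxE.
rewrite quadratic_diff //.
have -> : p + w *m M - p = w *m M by rewrite addrC addKr.
rewrite addrA !mulmxDl.
have -> : w *m M *m Q b *m (w *m M)^T = w *m K b *m w^T.
  by rewrite /K trmx_mul !mulmxA.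
have -> : p *m Q b *m (w *m M)^T = 2^-1 *: (row b (w^T)) .
  rewrite trmx_mul /M linearZ /= trmxK -scalemxAl -scalemxAr mulmxA.
  have -> : p *m Q b *m L = row b 1%:M by rewrite -GL row_mul rowK.
  by rewrite -row_mul mul1mx.
have := congr1 (fun z : 'rV[R]_s => z 0 b) wE.
rewrite /mkfun /f /q !mxE => ->.
apply/eqP; lra.
Qed.

End MatrixAnalysis.

Section Flexes.
Variables (R : realType) (N : nat).

Lemma quadratic_perturbation (I : finType) (Q : I -> 'M[R]_N) (B : {set I})
    (p : 'rV[R]_N) (i0 : I) :
  (forall i, (Q i)^T = Q i) -> independent (fun i => p *m Q i) B -> i0 \in B ->
  forall eps : R, 0 < eps -> exists x : 'rV[R]_N, [/\ `|x| < eps,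
    forall i, i \in B -> i != i0 ->
      ((p + x) *m Q i *m (p + x)^T) 0 0 = (p *m Q i *m p^T) 0 0 &
    ((p + x) *m Q i0 *m (p + x)^T) 0 0 <> (p *m Q i0 *m p^T) 0 0].
Proof.
move=> symQ iB i0B eps eps0.
have [||delta delta0 solve] :=
    @local_surjectivity R N #|B| (fun b => Q (enum_val b)) p _ _ _ eps0.
- by move=> b; exact: symQ.
- by rewrite -row_leq_rank; rewrite /independent span_of_enum in iB.
pose y : 'rV[R]_#|B| := \row_b (if b == enum_rank_in i0B i0 then delta / 2 else 0).
have yE i (iB' : i \in B) : y 0 (enum_rank_in i0B i) = if i == i0 then delta / 2 else 0.
  rewrite mxE; congr (if _ then _ else _); apply/eqP/eqP => [/(congr1 enum_val)|->//].
  by rewrite !enum_rankK_in.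
have [|x xeps xE] := solve y.
  rewrite (@le_lt_trans _ _ (delta / 2)) //; last by lra.
  apply: mx_norm_le => [|i b]; first by lra.
  by rewrite mxE; case: ifP => _; rewrite ?normr0 ?ger0_norm //; lra.
exists x; split=> // [i iB' ii0|].
  by have := xE (enum_rank_in i0B i); rewrite enum_rankK_in // yE // (negPf ii0) addr0.
have := xE (enum_rank_in i0B i0); rewrite enum_rankK_in // yE // eqxx => -> /eqP.
by rewrite -subr_eq0 addrC addKr => /eqP; lra.
Qed.

Variables (E : finType) (D : E -> 'M[R]_(N, 2)).

(* Solving only for a basis of the rows suffices: as the rank is maximal, the
   remaining rows at the midpoint of p and z are combinations of the basis. *)
Lemma flex (A : {set E}) (p : 'rV[R]_N) (S : 'M[R]_N) :
  (forall x, \rank (span_of (rigidity_row D x) A) <=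
             \rank (span_of (rigidity_row D p) A))%N ->
  S^T = S -> ~ (p *m S <= span_of (rigidity_row D p) A)%MS ->
  forall eps : R, 0 < eps -> exists z : 'rV[R]_N, [/\ `|z - p| < eps,
    forall e, e \in A -> sqlen D e z = sqlen D e p &
    (z *m S *m z^T) 0 0 <> (p *m S *m p^T) 0 0].
Proof.
move=> maxp symS nS eps eps0.
have [B [BA iB spanB]] := basis_exists (rigidity_row D p) A.
(* [None] adds the form [S], whose gradient at [p] is independent of the basis by [nS]. *)
pose Q (i : option E) := if i is Some e then D e *m (D e)^T else S.
have spanQ : (span_of (fun i => p *m Q i) (Some @: B)%SET :=: span_of (rigidity_row D p) B)%MS.
  apply/eqmxP/andP; split; apply: span_ofP.
    by move=> _ /imsetP[e eB ->]; exact: (mem_span_of (rigidity_row D p)).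
  move=> e eB; apply: (mem_span_of (fun i => p *m Q i) (i := Some e)).
  exact: imset_f.
have iQ : independent (fun i => p *m Q i) (None |: Some @: B).
  apply: independent_add; last by rewrite spanQ => /submx_trans/(_ (span_ofS _ BA)).
  by rewrite /independent spanQ card_imset //; exact: Some_inj.
have [r /= r0 near_r] : exists2 r : R, 0 < r & forall x, `|x - p| < r ->
    independent (rigidity_row D x) B.
  have /nbhs_ballP[r /= r0 hr] := independent_near iB.
  exists r => // x xr; apply: hr; rewrite -ball_normE /=.
  by rewrite distrC.
have [|||x [xr xB xS]] := quadratic_perturbation (i0 := None) _ iQ _ (eps := Num.min r eps).
- by case=> [e|//] /=; rewrite trmx_mul trmxK.
- by rewrite finset.setU11.
- by rewrite lt_min r0 eps0.
move: xr; rewrite lt_min => /andP[xr xeps].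
exists (p + x); split=> [|e eA|//]; first by rewrite addrC addKr.
apply/sqlen_eqP.
have -> : p + (p + x) = 2 *: (p + 2^-1 *: x).
  by rewrite scalerDr scalerA mulfV ?pnatr_eq0 // scale1r addrA -mulr2n scaler_nat.
set m := p + _.
have im : independent (rigidity_row D m) B.
  by apply: near_r; rewrite /m addrC addKr normrZ ger0_norm; lra.
(* The basis rows are still independent at the midpoint, and by maximality the rank there cannot
   exceed their number. *)
have spanm : (span_of (rigidity_row D m) A <= span_of (rigidity_row D m) B)%MS.
  have sBA := span_ofS (rigidity_row D m) BA.
  rewrite -(geq_leqif (mxrank_leqif_sup sBA)) (leq_trans (maxp m)) //.
  rewrite (leq_trans (mxrankS spanB)) // (independent_rank iB).
  exact: im.
have kerm : (span_of (rigidity_row D m) B <= kermx (p + x - p)^T)%MS.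
  apply/span_of_ker => f fB.
  have /sqlen_eqP : sqlen D f (p + x) = sqlen D f p.
    apply: (xB (Some f)) => //; rewrite !inE /=; exact: imset_f.
  have -> : p + (p + x) = 2 *: m.
    by rewrite /m scalerDr scalerA mulfV ?pnatr_eq0 // scale1r addrA -mulr2n scaler_nat.
  rewrite /rigidity_row -!scalemxAl => /eqP; rewrite scaler_eq0 pnatr_eq0 /=.
  by move/eqP.
have := submx_trans (mem_span_of _ eA) (submx_trans spanm kerm).
rewrite sub_kermx => /eqP h.
by rewrite /rigidity_row -!scalemxAl; rewrite /rigidity_row in h; rewrite h scaler0.
Qed.

End Flexes.

(** * Rotations and coordinates *)

Section Rotations.
Variables (R : realType) (k : nat).
Hypothesis hk : (1 < k)%N.

(** Points are handled as rows, so rotations act from the right and appear transposed. *)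
Definition row_rot (g : 'Z_k) : 'M[R]_2 :=
  (rotation_mx ((g : nat)%:R * (2 * pi / k%:R)))^T.

Lemma rot_row_rot (g : 'Z_k) (u : 'cV[R]_2) : rot g u = (u^T *m row_rot g)^T.
Proof. by rewrite trmx_mul !trmxK. Qed.

Lemma rotation_mxD (s t : R) : rotation_mx (s + t) = rotation_mx s *m rotation_mx t.
Proof.
by apply/matrixP; apply: ord2P; apply: ord2P; rewrite !mxE sum2E !mxE /= ?cosD ?sinD; lra.
Qed.

Let theta : R := 2 * pi / k%:R.

Let rotation_mxX n : rotation_mx (n%:R * theta) = rotation_mx theta ^+ n.
Proof.
elim: n => [|n IHn].
  rewrite mul0r expr0; apply/matrixP; apply: ord2P; apply: ord2P;
  by rewrite !mxE /= ?cos0 ?sin0 ?oppr0.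
by rewrite exprS -[in RHS]IHn -natr1 mulrDl mul1r addrC rotation_mxD.
Qed.

Let rotation_mxXk : rotation_mx theta ^+ k = 1.
Proof.
have k0 : k%:R != 0 :> R by rewrite pnatr_eq0; lia.
rewrite -rotation_mxX /theta mulrC divfK // mulr_natl.
apply/matrixP; apply: ord2P; apply: ord2P; rewrite !mxE /= ?cos2pi //;
by rewrite sin_mulr2n sinpi mulr0 mul0rn ?oppr0.
Qed.

(** Addition in ['Z_k] is modulo [k], which is harmless because the [k]-th power of the generating
    rotation is the identity. *)
Lemma row_rotD g h : row_rot (g + h) = row_rot g *m row_rot h.
Proof.
rewrite /row_rot -trmx_mul -/theta -rotation_mxD; congr trmx.
rewrite -mulrDl -natrD !rotation_mxX /= expr_mod; last by rewrite Zp_cast.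
by rewrite addnC.
Qed.

Lemma row_rot0 : row_rot 0 = 1%:M.
Proof. by rewrite /row_rot -/theta rotation_mxX expr0 trmx1. Qed.

Lemma row_rotK g : row_rot g *m row_rot (- g) = 1%:M.
Proof. by rewrite -row_rotD subrr row_rot0. Qed.

Lemma row_rot_turn g : row_rot g *m quarter_turn R = quarter_turn R *m row_rot g.
Proof.
by apply/matrixP; apply: ord2P; apply: ord2P; rewrite !mxE !sum2E !mxE /=; lra.
Qed.

Lemma row_rot_orthogonal g : row_rot g *m (row_rot g)^T = 1%:M.
Proof.
rewrite /row_rot; set t := _ * _; have := cos2Dsin2 t.
by move=> h; apply/matrixP; apply: ord2P; apply: ord2P; rewrite !mxE !sum2E !mxE /=; nra.
Qed.

Lemma row_rot_free g (u : 'rV[R]_2) : u != 0 -> u *m row_rot g = u -> g = 0.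
Proof.
move=> u0 ug; apply/eqP; apply: contraNT u0 => g0; apply/eqP.
have k0 : 0 < k%:R :> R by rewrite ltr0n; lia.
have ltgk : (g < k)%N by rewrite -[X in (_ < X)%N](Zp_cast hk) ltn_ord.
have gt0 : (0 < g)%N by rewrite lt0n; apply: contraNneq g0 => h; apply/eqP/val_inj.
(* Half the angle lies strictly between 0 and [pi], so its sine is positive and the cosine of the
   full angle is less than 1. *)
set t : R := (g : nat)%:R * (pi / k%:R).
have sint : 0 < sin t.
  apply: sin_gt0_pi; rewrite /t mulr_gt0 ?ltr0n ?divr_gt0 ?pi_gt0 //=.
  by rewrite mulrA ltr_pdivrMr // mulrC ltr_pM2l ?pi_gt0 // ltr_nat.
have c1 : cos ((g : nat)%:R * (2 * pi / k%:R)) < 1 :> R.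
  have -> : (g : nat)%:R * (2 * pi / k%:R) = t *+ 2 :> R.
    by rewrite /t -mulr_natr; lra.
  by rewrite cos_mulr2n; have := cos2Dsin2 t; rewrite !mulr2n; nra.
move: c1 ug; rewrite /row_rot; set a := _ * _ => c1 ug.
have := congr1 (fun v : 'rV__ => v 0 0) ug; have := congr1 (fun v : 'rV__ => v 0 1) ug.
rewrite !mxE !sum2E !mxE /= => e1 e0.
have cs := cos2Dsin2 a.
have s0 : u 0 0 ^+ 2 + u 0 1 ^+ 2 = 0.
  have : (1 - cos a) * (u 0 0 ^+ 2 + u 0 1 ^+ 2) = 0 by nra.
  by move=> /eqP; rewrite mulf_eq0 => /orP[/eqP|/eqP//]; lra.
move/eqP: s0; rewrite paddr_eq0 ?sqr_ge0 // !sqrf_eq0 => /andP[/eqP x0 /eqP x1].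
by apply/rowP; apply: ord2P; rewrite mxE.
Qed.

Lemma row_rot_inj g h (u : 'rV[R]_2) : u != 0 -> u *m row_rot g = u *m row_rot h -> g = h.
Proof.
move=> u0 gh; apply/eqP; rewrite -subr_eq0; apply/eqP/(row_rot_free u0).
by rewrite row_rotD mulmxA gh -mulmxA row_rotK mulmx1.
Qed.

End Rotations.

Section VertexCoordinates.
Variables (R : realType) (V : finType).
Local Notation N := #|{: V * 'I_2}|.

(** A coordinate projection: [x *m vertex_mx i] is the position of [i], as a row. *)
Definition vertex_mx (i : V) : 'M[R]_(N, 2) :=
  \matrix_(a, b) (enum_val a == (i, b))%:R.

Definition row_of (p : V -> 'cV[R]_2) : 'rV[R]_N := \row_a coordinates p a.

Definition placement_of (x : 'rV[R]_N) (i : V) : 'cV[R]_2 := (x *m vertex_mx i)^T.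

Lemma mul_vertex_mx (x : 'rV[R]_N) i b : (x *m vertex_mx i) 0 b = x 0 (enum_rank (i, b)).
Proof.
rewrite mxE (bigD1 (enum_rank (i, b))) //= mxE enum_rankK eqxx mulr1 big1 ?addr0 //.
move=> a ai; rewrite mxE; case: eqP => [h|_]; last by rewrite mulr0.
by move: ai; rewrite -h enum_valK eqxx.
Qed.

Lemma row_ofK p : placement_of (row_of p) = p.
Proof.
apply/funext => i; apply/colP => b; rewrite mxE mul_vertex_mx mxE /coordinates.
by rewrite enum_rankK.
Qed.

Lemma row_of_mul p i : row_of p *m vertex_mx i = (p i)^T.
Proof. by rewrite -[LHS]trmxK -/(placement_of _ i) row_ofK. Qed.

Lemma placement_ofK x : row_of (placement_of x) = x.
Proof.
apply/rowP => a; rewrite mxE /coordinates mxE mul_vertex_mx.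
by rewrite -surjective_pairing enum_valK.
Qed.

Lemma eq_row_vertex (x y : 'rV[R]_N) :
  (forall i, x *m vertex_mx i = y *m vertex_mx i) -> x = y.
Proof.
move=> h; rewrite -(placement_ofK x) -(placement_ofK y); congr row_of.
by apply/funext => i; rewrite /placement_of h.
Qed.

Lemma vertex_mx_orthogonal i j : (vertex_mx i)^T *m vertex_mx j = (i == j)%:R%:M.
Proof.
apply/matrixP => b c; rewrite !mxE (bigD1 (enum_rank (i, b))) //= !mxE enum_rankK eqxx mul1r.
rewrite big1 => [|a ai]; last first.
  rewrite !mxE; case: eqP => [h|_]; last by rewrite mul0r.
  by move: ai; rewrite -h enum_valK eqxx.
by rewrite addr0 xpair_eqE; case: (i == j); rewrite /= ?mul0rn.
Qed.

Lemma card_coordinates : N = (2 * #|V|)%N.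
Proof. by rewrite card_prod card_ord mulnC. Qed.

Definition block_mx_of (K : V -> 'M[R]_2) : 'M[R]_N :=
  \sum_i vertex_mx i *m K i *m (vertex_mx i)^T.

Lemma block_mx_ofE K i : block_mx_of K *m vertex_mx i = vertex_mx i *m K i.
Proof.
rewrite mulmx_suml (bigD1 i) //= big1 ?addr0 => [|j ji].
  by rewrite -mulmxA vertex_mx_orthogonal eqxx mulmx1.
by rewrite -mulmxA vertex_mx_orthogonal (negPf ji) raddf0 mulmx0.
Qed.

Definition turn_mx : 'M[R]_N := block_mx_of (fun _ => quarter_turn R).

Lemma turn_mx_sqr : turn_mx *m turn_mx = - 1%:M.
Proof.
apply/row_matrixP => a; apply: eq_row_vertex => i.
rewrite -row_mul -mulmxA block_mx_ofE mulmxA block_mx_ofE -mulmxA quarter_turn_sqr.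
by rewrite mulmxN mulmx1 -row_mul mulNmx mul1mx.
Qed.

End VertexCoordinates.

Section ColoredRows.
Variables (R : realType) (k : nat) (hk : (1 < k)%N) (C : colored_graph k).
Local Notation N := #|{: vertex C * 'I_2}|.
Local Notation W := (@vertex_mx R (vertex C)).
Local Notation Rot := (@row_rot R k).

(** The edge vector of the lift that starts at the representative of the source; by symmetry it
    determines the length of the whole orbit. *)
Definition edge_mx (e : edge C) : 'M[R]_(N, 2) :=
  W (edge_dst e) *m Rot (color e) - W (edge_src e).

Lemma mul_edge_mx m (x : 'M[R]_(m, N)) e :
  x *m edge_mx e = x *m W (edge_dst e) *m Rot (color e) - x *m W (edge_src e).
Proof. by rewrite mulmxBr mulmxA. Qed.

Lemma turn_edge_mx e : turn_mx R (vertex C) *m edge_mx e = edge_mx e *m quarter_turn R.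
Proof.
rewrite mul_edge_mx !block_mx_ofE -mulmxA -row_rot_turn mulmxA.
by rewrite /edge_mx mulmxBl.
Qed.

Lemma sqlen_edge_mx e (p : vertex C -> 'cV[R]_2) :
  sqlen edge_mx e (row_of p) =
  sqnorm (rot (color e) (p (edge_dst e)) - p (edge_src e)).
Proof.
rewrite /sqlen !mulmxA -mulmxA -trmx_mul mul_edge_mx !row_of_mul rot_row_rot.
rewrite mxE /sqnorm; apply: eq_bigr => b _; rewrite !mxE expr2.
by congr (_ * _); congr (_ - _); apply: eq_bigr => c _; rewrite !mxE.
Qed.

End ColoredRows.

(** * Potentials and components *)

Lemma ends_eq (G : mgraph) (e : edge G) x y : ends e = [set x; y]%SET ->
  (edge_src e = x /\ edge_dst e = y) \/ (edge_src e = y /\ edge_dst e = x).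
Proof.
rewrite /ends => h.
have : edge_src e \in [set x; y]%SET by rewrite -h finset.set21.
have : edge_dst e \in [set x; y]%SET by rewrite -h finset.set22.
have : x \in [set edge_src e; edge_dst e]%SET by rewrite h finset.set21.
have : y \in [set edge_src e; edge_dst e]%SET by rewrite h finset.set22.
rewrite !inE => /orP[] /eqP-> /orP[] /eqP-> /orP[] /eqP hd /orP[] /eqP hs;
  by rewrite ?hd ?hs; auto.
Qed.

Section Potentials.
Variables (k : nat) (C : colored_graph k).
Implicit Types (A B : {set edge C}) (X : {set vertex C}) (e : edge C).

(** The sign is such that rotating a fixed vector by [eta i] at each [i] gives zero edge vectors on
    [B]. *)
Definition potential_on B (eta : vertex C -> 'Z_k) :=
  forall e, e \in B -> color e = eta (edge_src e) - eta (edge_dst e).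

(** Summation by parts: [rho z] becomes a combination of the boundary values of [z], which vanish on
    cycles. *)
Lemma potential_trivial_rho B eta : potential_on B eta -> trivial_rho B.
Proof.
move=> heta z [zB bz]; rewrite /rho.
transitivity (\sum_e (eta (edge_src e) *~ z e - eta (edge_dst e) *~ z e)).
  apply: eq_bigr => e _; rewrite -mulrzBl.
  by have [/heta->//|/zB->] := boolP (e \in B); rewrite !mulr0z.
have sum_fibre (f : edge C -> vertex C) :
    \sum_e eta (f e) *~ z e = \sum_v eta v *~ (\sum_(e | f e == v) z e).
  rewrite (partition_big f xpredT) //=; apply: eq_bigr => v _.
  by rewrite mulrz_sumr; apply: eq_bigr => e /eqP->.
rewrite sumrB !sum_fibre -sumrB big1 // => v _.
by rewrite -mulrzBr -[X in _ *~ X]opprB -/(boundary z v) bz oppr0 mulr0z.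
Qed.

Lemma boundaryD (y z : {ffun edge C -> int}) v :
  boundary (y + z) v = boundary y v + boundary z v.
Proof.
rewrite /boundary addrACA -opprD -!big_split /=.
by congr (_ - _); apply: eq_bigr => e _; rewrite ffunE.
Qed.

Lemma boundary0 v : boundary (0 : {ffun edge C -> int}) v = 0.
Proof. by rewrite /boundary !big1 ?subrr // => e _; rewrite ffunE. Qed.

Lemma boundaryN (z : {ffun edge C -> int}) v : boundary (- z) v = - boundary z v.
Proof. by apply/eqP; rewrite -addr_eq0 -boundaryD addNr boundary0. Qed.

Lemma rhoD (y z : {ffun edge C -> int}) : rho (y + z) = rho y + rho z.
Proof. by rewrite /rho -big_split; apply: eq_bigr => e _; rewrite ffunE mulrzDr. Qed.

Lemma rhoN (z : {ffun edge C -> int}) : rho (- z) = - rho z.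
Proof. by rewrite /rho -sumrN; apply: eq_bigr => e _; rewrite ffunE mulrNz. Qed.

Definition edge_chain e : {ffun edge C -> int} := [ffun f => (f == e)%:Z].

Lemma boundary_edge e v :
  boundary (edge_chain e) v = (v == edge_dst e)%:Z - (v == edge_src e)%:Z.
Proof.
have fibre (f : edge C -> vertex C) :
    \sum_(e' | f e' == v) edge_chain e e' = (v == f e)%:Z.
  rewrite big_mkcond (bigD1 e) //= big1 => [|e' ee']; last first.
    by rewrite ffunE (negPf ee'); case: ifP.
  by rewrite ffunE eqxx addr0 eq_sym; case: ifP.
by rewrite /boundary !fibre.
Qed.

Lemma rho_edge e : rho (edge_chain e) = color e.
Proof.
rewrite /rho (bigD1 e) //= big1 => [|e' ee']; last by rewrite ffunE (negPf ee').
by rewrite ffunE eqxx addr0.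
Qed.

End Potentials.

Section Components.
Variables (k : nat) (C : colored_graph k) (A : {set edge C}).
Implicit Types (X : {set vertex C}) (e : edge C).

Lemma connect_adjacent_sym : connect_sym (adjacent A).
Proof.
apply: sym_connect_sym => x y; apply: eq_existsb => e.
by rewrite finset.setUC.
Qed.

Lemma connect_adjacent_equiv :
  {in span_vertices A & &, equivalence_rel (connect (adjacent A))}.
Proof.
move=> x y z _ _ _; split=> [|xy]; first exact: connect0.
exact: same_connect connect_adjacent_sym _ _ xy z.
Qed.

Let comps_partition := equivalence_partitionP connect_adjacent_equiv.

Let comps_triv : finset.trivIset (components A).
Proof. by case/and3P: comps_partition. Qed.

Let comps_cover : finset.cover (components A) = span_vertices A.
Proof. by case/and3P: comps_partition => /eqP. Qed.

Lemma span_verticesP e v : e \in A -> v \in ends e -> v \in span_vertices A.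
Proof. by move=> eA ve; apply/finset.bigcupP; exists e. Qed.

Lemma component_sub X v : X \in components A -> v \in X -> v \in span_vertices A.
Proof. by move=> XA vX; rewrite -comps_cover; apply/finset.bigcupP; exists X. Qed.

Lemma component_connect X x y : X \in components A -> x \in X ->
  y \in span_vertices A -> (y \in X) = connect (adjacent A) x y.
Proof.
move=> XA xX yA; rewrite -(pblock_equivalence_partition connect_adjacent_equiv) //.
  by rewrite (def_pblock comps_triv XA xX).
exact: component_sub xX.
Qed.

Lemma pblock_component v : v \in span_vertices A ->
  finset.pblock (components A) v \in components A /\
  v \in finset.pblock (components A) v.
Proof. by move=> vA; rewrite pblock_mem ?mem_pblock comps_cover. Qed.

Lemma component_edge X e : X \in components A -> e \in A ->
  (edge_src e \in X) || (edge_dst e \in X) -> e \in edges_in A X.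
Proof.
move=> XA eA sd; rewrite inE eA /=.
have cs : connect (adjacent A) (edge_src e) (edge_dst e).
  by apply: connect1; apply/existsP; exists e; rewrite eA /ends eqxx.
have sA : edge_src e \in span_vertices A by apply: span_verticesP eA _; rewrite finset.set21.
have dA : edge_dst e \in span_vertices A by apply: span_verticesP eA _; rewrite finset.set22.
rewrite finset.subUset !finset.sub1set; case/orP: sd => h; rewrite h ?andbT /=.
  by rewrite (component_connect XA h).
by rewrite (component_connect XA h) // connect_adjacent_sym.
Qed.

Lemma edges_in_ends X e : e \in edges_in A X -> edge_src e \in X /\ edge_dst e \in X.
Proof. by rewrite inE finset.subUset !finset.sub1set => /and3P[]. Qed.

(** Induction along a path; the step is an equivalence because paths may traverse edges
    backwards. *)
Lemma component_ind X (x0 : vertex C) (P : vertex C -> Prop) :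
  X \in components A -> x0 \in X -> P x0 ->
  (forall e, e \in edges_in A X -> P (edge_src e) <-> P (edge_dst e)) ->
  forall x, x \in X -> P x.
Proof.
move=> XA x0X P0 step x xX.
have := xX; rewrite (component_connect XA x0X) ?(component_sub XA) //.
move=> /connectP[p]; elim: p x0 x0X P0 => [|y p IHp] v vX Pv /=; first by move=> _ ->.
move=> /andP[/existsP[e /andP[eA /eqP /ends_eq ev]] py] xl.
have eX : e \in edges_in A X.
  by apply: component_edge => //; case: ev => -[-> ->]; rewrite vX ?orbT.
have [sX dX] := edges_in_ends eX; have se := step e eX.
by apply: IHp py xl; case: ev sX dX se => -[-> ->]; tauto.
Qed.

Lemma component_chain X x0 : X \in components A -> x0 \in X -> forall x, x \in X ->
  exists z : {ffun edge C -> int}, (forall e, e \notin edges_in A X -> z e = 0) /\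
    forall v, boundary z v = (v == x)%:Z - (v == x0)%:Z.
Proof.
move=> XA x0X; apply: (component_ind XA x0X).
  exists 0; split=> [e _|v]; first by rewrite ffunE.
  by rewrite subrr boundary0.
move=> e eX.
have supp f : f \notin edges_in A X -> (f == e) = false.
  by apply: contraNF => /eqP->.
split=> -[z [z0 bz]].
  exists (z + edge_chain e); split=> [f fX|v].
    by rewrite !ffunE z0 // supp.
  by rewrite boundaryD bz boundary_edge; lia.
exists (z - edge_chain e); split=> [f fX|v].
  by rewrite !ffunE z0 // supp.
by rewrite boundaryD boundaryN bz boundary_edge; lia.
Qed.

(** The potential at [x] is minus the total color of a chain from a base point to [x]. Going to the
    source of [e], along [e], and back from its target is a cycle, on which [rho] vanishes. *)
Lemma trivial_rho_potential X : X \in components A -> trivial_rho (edges_in A X) ->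
  exists eta, potential_on (edges_in A X) eta.
Proof.
move=> XA tX; have [X0|/finset.set0Pn[x0 x0X]] := eqVneq X finset.set0.
  by exists (fun=> 0) => e /edges_in_ends[sX _]; rewrite X0 finset.in_set0 in sX.
pose chain x (z : {ffun edge C -> int}) :=
  (forall e, e \notin edges_in A X -> z e = 0) /\
    forall v, boundary z v = (v == x)%:Z - (v == x0)%:Z.
pose zc x := xget 0 (chain x).
have zcP x : x \in X -> chain x (zc x).
  by move=> /(component_chain XA x0X)[z hz]; exact: (xgetPex 0 (ex_intro _ z hz)).
exists (fun x => - rho (zc x)) => e eX; have [sX dX] := edges_in_ends eX.
have [s0 bs] := zcP _ sX; have [d0 bd] := zcP _ dX.
have : rho (zc (edge_src e) + edge_chain e - zc (edge_dst e)) = 0.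
  apply: tX; split=> [f fX|v].
    rewrite !ffunE s0 // d0 //; case: eqP => [fe|]; last by rewrite !add0r oppr0.
    by rewrite fe eX in fX.
  by rewrite !boundaryD boundaryN bs bd boundary_edge; lia.
rewrite !rhoD rhoN rho_edge => /eqP; rewrite subr_eq0 => /eqP <-.
by rewrite opprK addKr.
Qed.

Lemma card_span_vertices : #|span_vertices A| = (\sum_(X in components A) #|X|)%N.
Proof. exact: card_partition comps_partition. Qed.

Lemma card_edges_components : #|A| = (\sum_(X in components A) #|edges_in A X|)%N.
Proof.
rewrite -sum1_card (partition_big (fun e => finset.pblock (components A) (edge_src e))
  (fun X => X \in components A)) /=; last first.
  move=> e eA; have [|//] := @pblock_component (edge_src e).
  by apply: span_verticesP eA _; rewrite finset.set21.
apply: eq_bigr => X XA; rewrite -sum1_card; apply: eq_bigl => e.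
apply/andP/idP => [[eA /eqP pe]|eX].
  have [|pc sp] := @pblock_component (edge_src e).
    by apply: span_verticesP eA _; rewrite finset.set21.
  by apply: component_edge => //; rewrite -pe sp.
have [sX _] := edges_in_ends eX; split; first by move: eX; rewrite inE => /andP[].
by rewrite (def_pblock comps_triv XA sX).
Qed.

Lemma components_neq0 : A != finset.set0 -> (0 < #|components A|)%N.
Proof.
move=> /finset.set0Pn[e eA]; apply/card_gt0P.
exists (finset.pblock (components A) (edge_src e)).
have [|//] := @pblock_component (edge_src e).
by apply: span_verticesP eA _; rewrite finset.set21.
Qed.

Lemma component_has_edge X : X \in components A -> exists e, e \in edges_in A X.
Proof.
move=> XA; have X0 : X != finset.set0.
  by apply: contraTneq XA => ->; case/and3P: comps_partition.
have /finset.set0Pn[x xX] := X0.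
have /finset.bigcupP[e eA xe] := component_sub XA xX; exists e; apply: component_edge => //.
by move: xe; rewrite !inE => /orP[] /eqP <-; rewrite xX ?orbT.
Qed.

Lemma card_components : (n_nontrivial A + n_trivial A)%N = #|components A|.
Proof.
rewrite /n_nontrivial /n_trivial.
rewrite -[RHS](cardsID [set X | `[< trivial_rho (edges_in A X) >]]%SET) addnC.
congr (_ + _)%N; apply: eq_card => X; rewrite !inE //.
by rewrite asbool_neg andbC.
Qed.

End Components.

(** * Sparsity counts *)

Section ConeSparsity.
Variables (R : realType) (k : nat) (hk : (1 < k)%N) (C : colored_graph k).
Local Notation N := #|{: vertex C * 'I_2}|.
Local Notation W := (@vertex_mx R (vertex C)).
Local Notation Rot := (@row_rot R k).
Local Notation D := (@edge_mx R k C).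
Local Notation J := (turn_mx R (vertex C)).
Implicit Types (A : {set edge C}) (X : {set vertex C}) (e : edge C).

Lemma edge_mx_ker m (x : 'M[R]_(m, N)) e : x *m D e = 0 <->
  x *m W (edge_dst e) *m Rot (color e) = x *m W (edge_src e).
Proof.
rewrite mul_edge_mx; split=> [/eqP|->]; last exact: subrr.
by rewrite subr_eq0 => /eqP.
Qed.

Lemma motion_component_eq0 A X (x : 'rV[R]_N) i :
  X \in components A -> (forall e, e \in A -> x *m D e = 0) ->
  i \in X -> x *m W i = 0 -> forall j, j \in X -> x *m W j = 0.
Proof.
move=> XA xD iX xi0; apply: (component_ind XA iX xi0) => e.
rewrite inE => /andP[/xD/edge_mx_ker eE _]; split=> h.
  by rewrite -[LHS]mulmx1 -(row_rotK R hk (color e)) mulmxA eE h mul0mx.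
by rewrite -eE h mul0mx.
Qed.

(** Otherwise each vector of the component is a rotated copy of one nonzero vector. The angle is
    unique because rotations act freely on nonzero vectors, so these angles form a potential. *)
Lemma motion_nontrivial_eq0 A X (x : 'rV[R]_N) :
  X \in components A -> (forall e, e \in A -> x *m D e = 0) ->
  ~ trivial_rho (edges_in A X) -> forall j, j \in X -> x *m W j = 0.
Proof.
move=> XA xD nt i iX; apply/eqP; apply: contra_notT nt => xi0.
have reach : forall j, j \in X -> exists g, x *m W j = x *m W i *m Rot g.
  apply: (component_ind XA iX); first by exists 0; rewrite row_rot0 ?mulmx1.
  move=> e; rewrite inE => /andP[/xD/edge_mx_ker eE _]; split=> -[g hg].
    exists (g - color e); rewrite row_rotD // mulmxA -hg -eE -mulmxA.
    by rewrite row_rotK // mulmx1.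
  by exists (g + color e); rewrite row_rotD // mulmxA -hg eE.
pose gain j : set 'Z_k := [set g | x *m W j = x *m W i *m Rot g].
pose eta j := xget 0 (gain j).
have etaP j : j \in X -> x *m W j = x *m W i *m Rot (eta j).
  by move=> /reach[g hg]; exact: (@xgetPex _ 0 (gain j) (ex_intro _ g hg)).
apply: (@potential_trivial_rho _ _ _ eta) => e eX; have [sX dX] := edges_in_ends eX.
apply/eqP; rewrite eq_sym subr_eq; apply/eqP; apply: (row_rot_inj hk xi0).
rewrite -etaP // addrC row_rotD // mulmxA -etaP //.
by move: eX; rewrite inE => /andP[/xD/edge_mx_ker].
Qed.

(** A vector with zero edge vectors vanishes on non-trivial components and is determined by one
    vertex on each trivial one. So adding the coordinates of a root per trivial component, and of
    the vertices outside [A], gives full rank. *)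
Lemma rank_directions A :
  (2 * #|span_vertices A| <= \rank (span_of (fun e => (D e)^T) A) + 2 * n_trivial A)%N.
Proof.
pose trivs := [set X in components A | `[< trivial_rho (edges_in A X) >]]%SET.
pose root (X : {set vertex C}) := [pick y in X].
pose roots := [set x | Some x \in (root @: trivs)%SET]%SET.
have roots_le : (#|roots| <= n_trivial A)%N.
  rewrite -(card_imset _ (@Some_inj _)).
  apply: leq_trans (leq_imset_card root trivs).
  by apply/subset_leq_card/fintype.subsetP => _ /imsetP[x + ->]; rewrite inE.
pose T := (~: span_vertices A :|: roots)%SET.
have full : (N <= \rank (span_of (fun e => (D e)^T) A + span_of (fun i => (W i)^T) T)%MS)%N.
  set M := (_ + _)%MS; suff: row_free M^T by rewrite -row_leq_rank mxrank_tr.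
  rewrite -kermx_eq0; apply/rowV0P => x; rewrite sub_kermx => /eqP xM.
  have /eqP : M *m x^T = 0 by rewrite -[LHS]trmxK trmx_mul trmxK xM trmx0.
  rewrite -sub_kermx addsmx_sub => /andP[/span_of_ker xD /span_of_ker xW].
  have {}xD e : e \in A -> x *m D e = 0.
    by move=> /xD h; rewrite -[LHS]trmxK trmx_mul h trmx0.
  have {}xW i : i \in T -> x *m W i = 0.
    by move=> /xW h; rewrite -[LHS]trmxK trmx_mul h trmx0.
  apply: eq_row_vertex => i; rewrite mul0mx.
  case: (boolP (i \in span_vertices A)) => iA; last by apply: xW; rewrite !inE iA.
  have [XA iX] := pblock_component iA; set X := finset.pblock _ _ in XA iX.
  case: (asboolP (trivial_rho (edges_in A X))) => tX; last first.
    exact: (motion_nontrivial_eq0 XA xD tX).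
  have XT : X \in trivs by rewrite inE XA; apply/asboolP.
  have := imset_f root XT; rewrite {1}/root.
  case: (@pickP _ (mem X)) => [y yX|/(_ i)]; last by rewrite /= iX.
  move=> yR; apply: (motion_component_eq0 XA xD yX) => //.
  by apply: xW; rewrite !inE yR orbT.
have := leq_trans full (mxrank_adds_leqif _ _).
have := rank_span_of (fun i => (W i)^T) T; have := card_coordinates (vertex C).
have := cardsC (span_vertices A).
have := (leq_card_setU (~: span_vertices A)%SET roots : (_ <= _)%N).
move: roots_le; rewrite -/T; clear; lia.
Qed.

Lemma rigidity_row_span A X (x : 'rV[R]_N) :
  (span_of (rigidity_row D x) (edges_in A X) <= span_of (fun i => (W i)^T) X)%MS.
Proof.
apply: span_ofP => e /edges_in_ends[sX dX].
rewrite /rigidity_row mulmxA; set y := x *m _.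
have -> : (D e)^T = (W (edge_dst e) *m Rot (color e))^T - (W (edge_src e))^T.
  exact: linearB.
rewrite mulmxBr addmx_sub ?eqmx_opp //.
  rewrite trmx_mul mulmxA; apply: submx_trans (submxMl _ _) _.
  exact: (mem_span_of (fun i => (W i)^T)).
apply: submx_trans (submxMl _ _) _.
exact: (mem_span_of (fun i => (W i)^T)).
Qed.

(* Velocity fields supported on a component and preserving its edge lengths;
   for the second, the two rows are translations along the axes, twisted by a
   potential [eta] so as to be symmetric. *)
Definition component_rotation X (x : 'rV[R]_N) : 'rV[R]_N :=
  x *m block_mx_of (fun i => if i \in X then quarter_turn R else 0).

Definition component_translation X (eta : vertex C -> 'Z_k) : 'M[R]_(2, N) :=
  \sum_(i in X) Rot (eta i) *m (W i)^T.

Lemma component_rotationE X x i :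
  component_rotation X x *m W i = if i \in X then x *m W i *m quarter_turn R else 0.
Proof.
rewrite /component_rotation -mulmxA block_mx_ofE mulmxA.
by case: ifP; rewrite ?mulmx0.
Qed.

Lemma component_translationE X eta i :
  component_translation X eta *m W i = if i \in X then Rot (eta i) else 0.
Proof.
rewrite mulmx_suml; under eq_bigr => j _ do rewrite -mulmxA vertex_mx_orthogonal.
case: ifP => iX.
  rewrite (bigD1 i) //= eqxx mulmx1 big1 ?addr0 // => j /andP[_ ji].
  by rewrite (negPf ji) raddf0 mulmx0.
rewrite big1 // => j jX; rewrite (_ : (j == i) = false) ?raddf0 ?mulmx0 //.
by apply: contraFF iX => /eqP <-.
Qed.

Lemma component_rotation_edge A X x e : e \in edges_in A X ->
  component_rotation X x *m D e = x *m D e *m quarter_turn R.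
Proof.
move=> /edges_in_ends[sX dX]; rewrite !mul_edge_mx !component_rotationE sX dX.
by rewrite mulmxBl -!mulmxA row_rot_turn.
Qed.

Lemma component_translation_edge A X eta e : potential_on (edges_in A X) eta ->
  e \in edges_in A X -> component_translation X eta *m D e = 0.
Proof.
move=> pe eX; have [sX dX] := edges_in_ends eX; apply/edge_mx_ker.
by rewrite !component_translationE sX dX -row_rotD // pe // addrC subrK.
Qed.

Lemma span_vertexP m X (x : 'M[R]_(m, N)) :
  (forall i, i \notin X -> x *m W i = 0) -> (x <= span_of (fun i => (W i)^T) X)%MS.
Proof.
move=> xX; have -> : x = \sum_(i in X) x *m W i *m (W i)^T.
  apply/row_matrixP => a; apply: eq_row_vertex => j; rewrite -!row_mul; congr row.
  rewrite mulmx_suml; under eq_bigr => i _ do rewrite -mulmxA vertex_mx_orthogonal.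
  case: (boolP (j \in X)) => jX.
    rewrite (bigD1 j) //= eqxx mulmx1 big1 ?addr0 // => i /andP[_ ij].
    by rewrite (negPf ij) raddf0 mulmx0.
  rewrite xX // big1 // => i iX.
  rewrite (_ : (i == j) = false) ?raddf0 ?mulmx0 //.
  by apply: contraNF jX => /eqP <-.
apply: summx_sub => i iX; apply: submx_trans (submxMl _ _) _.
exact: (mem_span_of (fun i => (W i)^T)).
Qed.

(** The rows of a component live in a space of dimension [2 * #|X|], and are orthogonal there to the
    rotation field and, given a potential, to two further translations. *)
Lemma component_maxwell A X x : X \in components A ->
  independent (rigidity_row D x) A ->
  (#|edges_in A X| + (if `[< trivial_rho (edges_in A X) >] then 3 else 1) <= 2 * #|X|)%N.
Proof.
move=> XA iA.
have sXA : edges_in A X \subset A by apply/fintype.subsetP => e; rewrite inE => /andP[].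
have iX : independent (rigidity_row D x) (edges_in A X) by exact: independentS iA.
have [e eX] := component_has_edge XA.
have xDe : x *m D e != 0.
  apply: contraTneq iX => xDe; rewrite /independent -ltnNge.
  have sD : (span_of (rigidity_row D x) (edges_in A X) <=
      span_of (rigidity_row D x) (edges_in A X :\ e))%MS.
    apply: span_ofP => f fX; have [->|fe] := eqVneq f e.
      by rewrite /rigidity_row mulmxA xDe mul0mx sub0mx.
    by apply: mem_span_of; rewrite !inE fe; rewrite inE in fX.
  rewrite (leq_ltn_trans (mxrankS sD)) // (leq_ltn_trans (rank_span_of _ _)) //.
  by rewrite mul1n [X in (_ < X)%N](cardsD1 e) eX.
have bound q (U : 'M[R]_(q, N)) : row_free U ->
    (forall i, i \notin X -> U *m W i = 0) ->
    (forall f, f \in edges_in A X -> rigidity_row D x f *m U^T = 0) ->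
    (#|edges_in A X| + q <= 2 * #|X|)%N.
  move=> fU sU oU; apply: leq_trans (rank_span_of (fun i => (W i)^T) X).
  rewrite -(independent_rank iX) -(eqP fU); apply: rank_orthogonal.
  - apply/eqP; rewrite -sub_kermx; apply: span_ofP => f /oU/eqP.
    by rewrite sub_kermx.
  - exact: rigidity_row_span.
  - exact: span_vertexP.
pose u := component_rotation X x.
have uX i : i \notin X -> u *m W i = 0 by move=> /negPf iX'; rewrite component_rotationE iX'.
have uo f : f \in edges_in A X -> rigidity_row D x f *m u^T = 0.
  move=> fX; rewrite /rigidity_row -!mulmxA -trmx_mul (component_rotation_edge _ fX).
  rewrite trmx_mul trmx_quarter_turn mulNmx !mulmxN !mulmxA.
  by rewrite quarter_turn_perp oppr0.
have ue : u *m D e != 0.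
  rewrite (component_rotation_edge _ eX); apply: contra_neq xDe => h.
  apply: oppr_inj; rewrite oppr0 -[x *m D e]mulmx1 -mulmxN -quarter_turn_sqr.
  by rewrite mulmxA h mul0mx.
case: asboolP => tX; last first.
  apply: (bound 1 u) => //; rewrite /row_free rank_rV.
  by apply/eqP; rewrite (_ : u != 0) //; apply: contra_neq ue => ->; rewrite mul0mx.
have [eta pe] := trivial_rho_potential XA tX.
pose U := col_mx u (component_translation X eta).
apply: (bound _ U) => [|i iX'|f fX].
(* Applying [D e] kills the translations and isolates the rotation coefficient; at one vertex the
   translations then form an invertible rotation matrix. *)
- rewrite -kermx_eq0; apply/rowV0P => c; rewrite sub_kermx => /eqP.
  rewrite -[c]hsubmxK mul_row_col; set c1 := lsubmx c; set c2 := rsubmx c => cU.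
  have c10 : c1 = 0.
    have := congr1 (mulmx^~ (D e)) cU; rewrite mulmxDl -(mulmxA c1) -(mulmxA c2) mul0mx.
    rewrite (component_translation_edge pe eX) mulmx0 addr0.
    rewrite [c1]mx11_scalar mul_scalar_mx => /eqP.
    by rewrite scaler_eq0 (negPf ue) orbF => /eqP->; rewrite raddf0.
  move: cU; rewrite c10 mul0mx add0r => cU.
  have [sX _] := edges_in_ends eX.
  have := congr1 (mulmx^~ (W (edge_src e))) cU.
  rewrite -mulmxA component_translationE sX mul0mx.
  move=> /(congr1 (mulmx^~ (Rot (- eta (edge_src e))))).
  by rewrite -mulmxA row_rotK // mulmx1 mul0mx => ->; rewrite row_mx0.
- rewrite mul_col_mx uX // component_translationE (negPf iX') col_mx0 //.
- rewrite tr_col_mx mul_mx_row uo // /rigidity_row -!mulmxA -trmx_mul.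
  by rewrite (component_translation_edge pe fX) trmx0 !mulmx0 row_mx0.
Qed.

Lemma maxwell_count A x : independent (rigidity_row D x) A ->
  (#|A| + n_nontrivial A + 3 * n_trivial A <= 2 * #|span_vertices A|)%N.
Proof.
move=> iA; rewrite (card_span_vertices A) big_distrr /= {1}card_edges_components.
pose t X := `[< trivial_rho (edges_in A X) >].
have nt : n_nontrivial A = (\sum_(X in components A) if ~~ t X then 1 else 0)%N.
  rewrite /n_nontrivial -sum1_card -big_mkcondr /=.
  by apply: eq_bigl => X; rewrite inE asbool_neg.
have tr : n_trivial A = (\sum_(X in components A) if t X then 1 else 0)%N.
  by rewrite /n_trivial -sum1_card -big_mkcondr /=; apply: eq_bigl => X; rewrite inE.
rewrite nt tr big_distrr -!big_split /=; apply: leq_sum => X XA.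
by have := component_maxwell XA iA; rewrite -/(t X); case: (t X) => /=; lia.
Qed.

End ConeSparsity.

(** * Generic independence *)

Section ConeLamanIndependence.
Variables (R : realType) (k : nat) (hk : (1 < k)%N) (C : colored_graph k).
Local Notation N := #|{: vertex C * 'I_2}|.
Local Notation D := (@edge_mx R k C).

Theorem cone_laman_independent :
  cone_laman C <-> N = #|edge C|.+1 /\
    exists x, independent (rigidity_row D x) [set: edge C]%SET.
Proof.
have hN := card_coordinates (vertex C).
have count_eq a b c : a = (2 * b)%N -> (c%:Z = 2 * b%:Z - 1 <-> a = c.+1) by lia.
have count_le (a s m t : nat) :
    a%:Z <= 2 * s%:Z - m%:Z - 3 * t%:Z <-> (a + m + 3 * t <= 2 * s)%N.
  by lia.
rewrite /cone_laman (propext (count_eq _ _ _ hN)).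
split=> [[hm hA]|[hm [x ix]]]; last first.
  split=> // A _; apply/count_le.
  exact: (maxwell_count hk (independentS (finset.subsetT A) ix)).
split=> //; apply: (independent_point_exists (@turn_edge_mx R k C) hm) => A A0.
(* The rank is at least the number of edges plus the number of components, and there is at least one
   component. *)
have /count_le := hA A A0; have := components_neq0 A0; rewrite -card_components.
have := rank_directions R hk A; set r := \rank _ => h2 h1 h3.
by suff : (#|A| < r)%N by []; move: h1 h2 h3; clear; lia.
Qed.

End ConeLamanIndependence.

(** * Polynomial functions of the coordinates *)

Section PolynomialFunctions.
Variables (R : realType) (N : nat).

Definition polynomial_fun (f : 'rV[R]_N -> R) :=
  exists q : mpoly N R, forall x, f x = meval (fun a => x 0 a) q.

Lemma polynomial_const c : polynomial_fun (fun=> c).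
Proof. by exists (mpolyC N c) => x; rewrite mevalC. Qed.

Lemma polynomial_coord a : polynomial_fun (fun x => x 0 a).
Proof. by exists (mpolyX R (mnm1 a)) => x; rewrite mevalXU. Qed.

Lemma polynomialD f g :
  polynomial_fun f -> polynomial_fun g -> polynomial_fun (fun x => f x + g x).
Proof. by move=> [p fp] [q gq]; exists (p + q) => x; rewrite mevalD fp gq. Qed.

Lemma polynomialM f g :
  polynomial_fun f -> polynomial_fun g -> polynomial_fun (fun x => f x * g x).
Proof. by move=> [p fp] [q gq]; exists (p * q) => x; rewrite mevalM fp gq. Qed.

Lemma polynomial_sum (I : finType) (f : I -> 'rV[R]_N -> R) :
  (forall i, polynomial_fun (f i)) -> polynomial_fun (fun x => \sum_i f i x).
Proof.
move=> fp; elim: (index_enum I) => [|i s IHs].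
  by under eq_fun do rewrite big_nil; exact: polynomial_const.
by under eq_fun do rewrite big_cons; exact: polynomialD.
Qed.

Lemma polynomial_prod (I : finType) (f : I -> 'rV[R]_N -> R) :
  (forall i, polynomial_fun (f i)) -> polynomial_fun (fun x => \prod_i f i x).
Proof.
move=> fp; elim: (index_enum I) => [|i s IHs].
  by under eq_fun do rewrite big_nil; exact: polynomial_const.
by under eq_fun do rewrite big_cons; exact: polynomialM.
Qed.

Lemma polynomial_mulmx n (K : 'M[R]_(N, n)) b : polynomial_fun (fun x => (x *m K) 0 b).
Proof.
under eq_fun do rewrite mxE; apply: polynomial_sum => a.
by apply: polynomialM; [exact: polynomial_coord|exact: polynomial_const].
Qed.

Lemma polynomial_det n (A : 'rV[R]_N -> 'M[R]_n) :
  (forall i j, polynomial_fun (fun x => A x i j)) -> polynomial_fun (fun x => \det (A x)).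
Proof.
move=> Ap; apply: polynomial_sum => s; apply: polynomialM; first exact: polynomial_const.
exact: polynomial_prod.
Qed.

Lemma polynomial_line_poly f : polynomial_fun f -> line_poly f.
Proof.
move=> [q fq] x v.
exists (\sum_(m <- msupp q) (mcoeff m q)%:P *
          \prod_i ((x 0 i)%:P + (v 0 i) *: 'X) ^+ m i) => t.
rewrite fq mevalE horner_sum; apply: eq_bigr => m _.
rewrite hornerM hornerC horner_prod; congr (_ * _); apply: eq_bigr => i _.
by rewrite horner_exp !hornerE !mxE mulrC.
Qed.

End PolynomialFunctions.

(** * The centralizer of the rotations *)

Section EuclideanIsometries.
Variable R : realType.
Implicit Types u v : 'cV[R]_2.

Lemma sqnormE u : sqnorm u = (u^T *m u) 0 0.
Proof. by rewrite mxE; apply: eq_bigr => i _; rewrite mxE expr2. Qed.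

Lemma sqnorm_ge0 u : 0 <= sqnorm u.
Proof. by apply: sumr_ge0 => i _; exact: sqr_ge0. Qed.

Lemma edist_sqr u v : edist u v ^+ 2 = sqnorm (v - u).
Proof. by rewrite sqr_sqrtr // sqnorm_ge0. Qed.

Lemma sqnormN u : sqnorm (- u) = sqnorm u.
Proof. by apply: eq_bigr => i _; rewrite mxE sqrrN. Qed.

Lemma edist_sym u v : edist u v = edist v u.
Proof. by rewrite /edist -sqnormN opprB. Qed.

(** Together with [edist_le_norm], this links Euclidean lengths to the sup norm that gives the
    topology. *)
Lemma norm_le_edist u v : `|v - u| <= edist u v.
Proof.
apply: mx_norm_le => [|i j]; first exact: sqrtr_ge0.
rewrite ord1 -sqrtr_sqr ler_sqrt; last exact: sqnorm_ge0.
by rewrite /sqnorm (bigD1 i) //= lerDl sumr_ge0 // => l _; exact: sqr_ge0.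
Qed.

Lemma edist_le_norm u v : edist u v <= 2 * `|v - u|.
Proof.
have n0 : 0 <= 2 * `|v - u| by rewrite mulr_ge0.
rewrite -(ger0_norm n0) -sqrtr_sqr ler_sqrt ?sqr_ge0 // /sqnorm sum2E.
have h i : (v - u) i 0 ^+ 2 <= `|v - u| ^+ 2.
  by rewrite -(real_normK (num_real ((v - u) i 0))) ler_sqr ?nnegrE // le_mx_norm.
by have := h 0; have := h 1; rewrite exprMn; nra.
Qed.

Variables (k : nat) (hk : (1 < k)%N).

Lemma rotB (g : 'Z_k) u v : rot g (u - v) = rot g u - rot g v.
Proof. exact: mulmxBr. Qed.

Lemma rotD (g h : 'Z_k) u : rot (g + h) u = rot g (rot h u).
Proof. by rewrite !rot_row_rot trmxK -mulmxA -row_rotD // addrC. Qed.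

Lemma rot0 u : rot (0 : 'Z_k) u = u.
Proof. by rewrite rot_row_rot row_rot0 // mulmx1 trmxK. Qed.

Lemma sqnorm_rot (g : 'Z_k) u : sqnorm (rot g u) = sqnorm u.
Proof.
rewrite !sqnormE rot_row_rot trmxK trmx_mul [u^T^T]trmxK mulmxA -(mulmxA _ (row_rot _ g)).
by rewrite row_rot_orthogonal mulmx1.
Qed.

Lemma edist_rot (g : 'Z_k) u v : edist (rot g u) (rot g v) = edist u v.
Proof. by rewrite /edist -rotB sqnorm_rot. Qed.

Lemma rot_free (g : 'Z_k) u : u != 0 -> rot g u = u -> g = 0.
Proof.
move=> u0; rewrite rot_row_rot => h.
apply: (@row_rot_free R k hk g u^T); first by rewrite trmx_eq0.
by rewrite -[LHS]trmxK h.
Qed.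

(** The image of the origin is fixed by a nontrivial rotation, hence is the origin; an isometry
    fixing the origin preserves inner products by polarization. This covers reflections too, should
    they centralize the group. *)
Lemma Cent_dot f : @Cent R k f -> forall u v, (f u)^T *m f v = u^T *m v.
Proof.
move=> [[_ fd] fr].
have one0 : (1 : 'Z_k) != 0 by exact: oner_neq0.
have f0 : f 0 = 0.
  apply/eqP; apply: contraT => f00; case/eqP: one0.
  apply: (rot_free f00); rewrite -fr; congr f; exact: mulmx0.
have sq u v : sqnorm (f u - f v) = sqnorm (u - v).
  by rewrite -!edist_sqr fd.
have sq0 u : sqnorm (f u) = sqnorm u by have := sq u 0; rewrite f0 !subr0.
have polar u v : sqnorm (u - v) = sqnorm u + sqnorm v - 2 * (u^T *m v) 0 0.
  by rewrite /sqnorm !mxE !sum2E !mxE; lra.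
move=> u v; apply/matrixP => i j; rewrite !ord1.
by have := sq u v; rewrite !polar !sq0; lra.
Qed.

Lemma Cent_isometry_near f (u : 'cV[R]_2) : @Cent R k f ->
  forall eps : R, 0 < eps -> \forall v \near u, `|f v - f u| < eps.
Proof.
move=> [[_ fd] _] eps eps0; apply/nbhs_ballP.
exists (eps / 2) => /=; first by rewrite divr_gt0.
move=> v; rewrite -ball_normE /= => uv.
rewrite (le_lt_trans (norm_le_edist _ _)) // fd (le_lt_trans (edist_le_norm _ _)) //.
by rewrite distrC; lra.
Qed.

Definition linear_turn (a b : R) u : 'cV[R]_2 :=
  (u^T *m (a%:M + b *: quarter_turn R))^T.

Lemma linear_turn_Cent a b : a ^+ 2 + b ^+ 2 = 1 -> @Cent R k (linear_turn a b).
Proof.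
move=> ab1.
have K c d : c ^+ 2 + d ^+ 2 = 1 -> cancel (linear_turn c d) (linear_turn c (- d)).
  move=> cd1 u; rewrite /linear_turn trmxK -mulmxA.
  suff -> : (c%:M + d *: quarter_turn R) *m (c%:M + - d *: quarter_turn R) = 1%:M.
    by rewrite mulmx1 trmxK.
  by apply/matrixP; apply: ord2P; apply: ord2P; rewrite !mxE sum2E !mxE /=; nra.
split; [split|].
- exists (linear_turn a (- b)); first exact: K.
  by have := K a (- b); rewrite opprK; apply; rewrite sqrrN.
- move=> u v; rewrite /edist; congr Num.sqrt.
  have -> : linear_turn a b v - linear_turn a b u = linear_turn a b (v - u).
    by rewrite /linear_turn -linearB /= -mulmxBl linearB.
  move: (v - u) => w; rewrite /sqnorm !sum2E /linear_turn !mxE !sum2E !mxE /=.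
  by nra.
- move=> g u; rewrite !rot_row_rot /linear_turn !trmxK -!mulmxA; congr (_ *m _)^T.
  by rewrite mulmxDr mulmxDl -scalemxAr -scalemxAl row_rot_turn scalar_mxC.
Qed.

(* Cayley transform: [t] is the tangent of half the angle. *)
Lemma cayley (u v : 'cV[R]_2) t :
  v^T - u^T = t *: ((u^T + v^T) *m quarter_turn R) ->
  v = linear_turn ((1 - t ^+ 2) / (1 + t ^+ 2)) (2 * t / (1 + t ^+ 2)) u.
Proof.
move=> h; set d := 1 + t ^+ 2; have d0 : d != 0.
  by apply: lt0r_neq0; have := sqr_ge0 t; rewrite /d; lra.
have entry b := congr1 (fun w : 'rV[R]_2 => w 0 b) h.
have h0 : v 0 0 - u 0 0 = t * - (u 1 0 + v 1 0).
  by move: (entry 0) => /=; rewrite [X in _ = X]mxE quarter_turnE !mxE.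
have h1 : v 1 0 - u 1 0 = t * (u 0 0 + v 0 0).
  by move: (entry 1) => /=; rewrite [X in _ = X]mxE quarter_turnE !mxE.
apply/colP; apply: ord2P; rewrite /linear_turn !mxE sum2E !mxE /=; apply: (mulIf d0).
- have -> : (u 0 0 * ((1 - t ^+ 2) / d *+ 1 + 2 * t / d * 0) +
       u 1 0 * ((1 - t ^+ 2) / d *+ 0 + 2 * t / d * -1)) * d =
     (u 0 0 * (1 - t ^+ 2) - u 1 0 * (2 * t)) * (d / d) by lra.
  by rewrite divff // mulr1 /d; move/(congr1 ( *%R t)): h1; lra.
- have -> : (u 0 0 * ((1 - t ^+ 2) / d *+ 0 + 2 * t / d * 1) +
       u 1 0 * ((1 - t ^+ 2) / d *+ 1 + 2 * t / d * 0)) * d =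
     (u 1 0 * (1 - t ^+ 2) + u 0 0 * (2 * t)) * (d / d) by lra.
  by rewrite divff // mulr1 /d; move/(congr1 ( *%R t)): h0; lra.
Qed.

Lemma cayley_unit (t : R) :
  ((1 - t ^+ 2) / (1 + t ^+ 2)) ^+ 2 + (2 * t / (1 + t ^+ 2)) ^+ 2 = 1.
Proof.
set d := 1 + t ^+ 2; have d0 : d != 0.
  by apply: lt0r_neq0; have := sqr_ge0 t; rewrite /d; lra.
have d20 : d ^+ 2 != 0 by rewrite expf_neq0.
rewrite !exprMn -mulrDl exprVn; apply: (mulIf d20).
by rewrite mulfVK // /d; lra.
Qed.

End EuclideanIsometries.

(** * Rigidity and rank *)

Lemma nbhs_placement (R : realType) (G : mgraph) (F : set_system (placement R G))
    {FF : Filter F} (P : placement R G) :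
  (forall i : vertex G, (fun P' : placement R G => P' i) @ F --> P i) -> F --> P.
Proof.
move=> h; apply/cvg_sup => i A /= [_ [[B oB <-] BPi] BA].
apply: filterS BA _; apply: (h i B); exact: open_nbhs_nbhs.
Qed.

(* G is the symmetric graph, possibly with an edge orbit deleted, and A is the
   set of edge orbits that remain. [proj], [rep] and [off] stand for [projV],
   [rep] and [vertex_offset]. *)
Section RigidityCriteria.
Variables (R : realType) (k : nat) (hk : (1 < k)%N) (C : colored_graph k).
Variables (G : mgraph) (aV : {action 'Z_k &-> vertex G}) (len : edge G -> R).
Variables (proj : vertex G -> vertex C) (rep : vertex C -> vertex G).
Variable off : vertex G -> 'Z_k.
Hypothesis rep_off : forall x, aV (rep (proj x)) (off x) = x.
Hypothesis proj_rep : forall i g, proj (aV (rep i) g) = i.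
Hypothesis off_rep : forall i g, off (aV (rep i) g) = g.
Variable A : {set edge C}.
Local Notation N := #|{: vertex C * 'I_2}|.
Local Notation D := (@edge_mx R k C).
Local Notation J := (turn_mx R (vertex C)).
Local Notation W := (@vertex_mx R (vertex C)).

(** [symmetric_placement] for the abstract data, so as to apply also after an edge orbit is
    deleted. *)
Definition extension (p : vertex C -> 'cV[R]_2) : placement R G :=
  fun x => rot (off x) (p (proj x)).

Variable p0 : vertex C -> 'cV[R]_2.
Hypothesis realizationsE : forall P : placement R G,
  realizations aV len P <->
  (forall (g : 'Z_k) i, P (aV i g) = rot g (P i)) /\
  forall e, e \in A ->
    sqlen D e (row_of (fun i => P (rep i))) = sqlen D e (row_of p0).

Lemma rep_act0 i : aV (rep i) (0 : 'Z_k) = rep i.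
Proof. exact: act1. Qed.

Lemma extension_rep p i : extension p (rep i) = p i.
Proof. by rewrite /extension -(rep_act0 i) off_rep proj_rep rot0. Qed.

Lemma extension_act p g i : extension p (aV i g) = rot g (extension p i).
Proof.
rewrite -{1}(rep_off i) -actM /extension off_rep proj_rep.
have -> : (off i * g)%g = g + off i by exact: addrC.
by rewrite rotD.
Qed.

Lemma extension_of (P : placement R G) :
  (forall (g : 'Z_k) i, P (aV i g) = rot g (P i)) ->
  P = extension (fun i => P (rep i)).
Proof. by move=> symP; apply/funext => x; rewrite -{1}(rep_off x) symP. Qed.

Lemma extension_realization : realizations aV len (extension p0).
Proof.
apply/realizationsE; split=> [g i|e _]; first exact: extension_act.
by congr (sqlen _ _ (row_of _)); apply/funext => i; rewrite extension_rep.
Qed.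

(** Near [p0] the midpoint keeps the rank, so [local_rigidity] applies. Its common scalar [t]
    yields, through [cayley], the same rotation at every vertex. *)
Lemma congruent_near : (2 <= N)%N ->
  (N <= (\rank (span_of (rigidity_row D (row_of p0)) A)).+1)%N ->
  exists2 r : R, 0 < r & forall P : placement R G, realizations aV len P ->
    (forall i, `|P (rep i) - p0 i| < r) ->
    exists2 f, @Cent R k f & forall x, P x = f (extension p0 x).
Proof.
move=> N2 rA; set y := row_of p0.
have [B [BA iB spanB]] := basis_exists (rigidity_row D y) A.
have /nbhs_ballP[r /= r0 near_r] := independent_near iB.
exists r => // P PR Pr; have [symP lenP] := (realizationsE P).1 PR.
set z := row_of (fun i => P (rep i)) in lenP *.
have zr : `|z - y| <= r.
  apply: mx_norm_le => [|i a]; first exact: ltW.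
  rewrite !mxE /coordinates; apply/ltW/le_lt_trans/(Pr (enum_val a).1).
  have := le_mx_norm (P (rep (enum_val a).1) - p0 (enum_val a).1) (enum_val a).2 0.
  by rewrite !mxE.
have mE : y + z = 2 *: (y + 2^-1 *: (z - y)).
  rewrite scalerDr scalerA mulfV ?pnatr_eq0 // scale1r scaler_nat mulr2n.
  by rewrite -addrA [y + (z - y)]addrC subrK.
have [|t zy] := local_rigidity (@turn_mx_sqr R (vertex C)) (@turn_edge_mx R k C) N2 _ lenP.
  apply: leq_trans rA _; rewrite ltnS.
  set m := y + 2^-1 *: (z - y) in mE; have im : independent (rigidity_row D m) B.
    apply: near_r; rewrite -ball_normE /= /m opprD addrA subrr sub0r normrN normrZ.
    by rewrite ger0_norm; lra.
  rewrite (leq_trans (mxrankS spanB)) // (independent_rank iB) (leq_trans im) //.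
  apply/mxrankS/span_ofP => e eB.
  have -> : rigidity_row D m e = 2^-1 *: rigidity_row D (y + z) e.
    by rewrite mE /rigidity_row -scalemxAl scalerA mulVf ?scale1r // pnatr_eq0.
  by apply/scalemx_sub/mem_span_of; exact: (fintype.subsetP BA).
exists (linear_turn ((1 - t ^+ 2) / (1 + t ^+ 2)) (2 * t / (1 + t ^+ 2))).
  exact/linear_turn_Cent/cayley_unit.
have zi i : P (rep i) =
    linear_turn ((1 - t ^+ 2) / (1 + t ^+ 2)) (2 * t / (1 + t ^+ 2)) (p0 i).
  apply: cayley; have := congr1 (mulmx^~ (W i)) zy.
  by rewrite mulmxBl -scalemxAl -mulmxA block_mx_ofE mulmxA mulmxDl !row_of_mul.
have [_ fr] := linear_turn_Cent k (cayley_unit t).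
by move=> x; rewrite (extension_of symP) /extension zi fr.
Qed.

Lemma realization_Cent f (P : placement R G) : @Cent R k f ->
  realizations aV len P -> realizations aV len (fun i => f (P i)).
Proof.
move=> [[_ fd] fr] [lenP symP]; split=> [e|g i]; first by rewrite fd lenP.
by rewrite symP fr.
Qed.

(** A point of the quotient is open when its congruence class is open among the realizations, and
    [congruent_near] shows this at [p0]. *)
Theorem rigid_of_rank : (2 <= N)%N ->
  (N <= (\rank (span_of (rigidity_row D (row_of p0)) A)).+1)%N ->
  rigid aV len (extension p0).
Proof.
move=> N2 rA; have [r r0 near_r] := congruent_near N2 rA.
pose x : realizations aV len := 
  exist (fun P => P \in realizations aV len) _ (mem_set extension_realization).
exists x => //; split; first by rewrite inE.
exists [set \pi_(config_space aV len)%qT x]; last by rewrite setIT.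
apply: open_nbhs_nbhs; split=> //.
suff : open (\pi_(config_space aV len)%qT @^-1` [set \pi_(config_space aV len)%qT x]) by [].
(* At another member [y] of the class, the inverse [h] of the congruence [f] carries a neighbourhood
   of [y] back to one of [p0]. *)
rewrite openE => y /= /esym /eqmodP /asboolP[f Cf fxy].
have [[[h fK hK] _] _] := Cf; have Ch := Cent_inv Cf fK hK.
have : \forall z \near y, forall i : vertex C,
    `|h ((val z : placement R G) (rep i)) - p0 i| < r.
  apply: (@filter_forall _ _ (fun (i : vertex C) (z : realizations aV len) =>
    `|h ((val z : placement R G) (rep i)) - p0 i| < r) (nbhs y)) => i.
  have -> : p0 i = h ((val y : placement R G) (rep i)).
    by rewrite fxy fK /= extension_rep.
  have near_val : nbhs (val y : placement R G) [set P : placement R G |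
      `|h (P (rep i)) - h ((val y : placement R G) (rep i))| < r].
    have near_h := Cent_isometry_near ((val y : placement R G) (rep i)) Ch r0.
    exact: (@proj_continuous (vertex G) (fun _ => 'cV[R]_2) (rep i) (val y) _ near_h).
  exact: (@initial_continuous _ _ (val : realizations aV len -> placement R G) y _ near_val).
apply: filterS => z zr; apply/esym/eqmodP/asboolP.
have zR : realizations aV len (val z) := set_valP z.
have [f' Cf' hz] := near_r _ (realization_Cent Ch zR) zr.
exists (f \o f'); first exact: (Cent_comp Cf Cf').
by move=> i; rewrite /= -hz hK.
Qed.

Lemma extension_continuous : continuous (fun z : 'rV[R]_N => extension (placement_of z)).
Proof.
move=> z; apply: (@nbhs_placement _ _ _ (fmap_filter _ (nbhs_filter z))) => x.
have -> : (fun P' : placement R G => P' x) @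
    ((fun z : 'rV[R]_N => extension (placement_of z)) @ z) =
    (fun z : 'rV[R]_N => rot (off x) (placement_of z (proj x))) @ z by [].
apply/(@cvgrPdist_lt _ _ _ _ (nbhs_filter z)) => eps eps0.
pose K := W (proj x) *m row_rot R (off x).
have rotE w : rot (off x) (placement_of w (proj x)) = (w *m K)^T.
  by rewrite rot_row_rot trmxK mulmxA.
have K1 : 0 < abs_sum K + 1 by rewrite ltr_wpDl ?abs_sum_ge0.
apply/nbhs_ballP; exists (eps / (abs_sum K + 1)); first by rewrite /= divr_gt0.
move=> w; rewrite -ball_normE /= => zw; rewrite /extension !rotE.
have -> : (z *m K)^T - (w *m K)^T = ((z - w) *m K)^T by rewrite mulmxBl linearB.
have -> : `|((z - w) *m K)^T| = `|(z - w) *m K|.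
  by apply/le_anti/andP; split; apply: mx_norm_le => // i j;
    [rewrite mxE|have := le_mx_norm ((z - w) *m K)^T j i; rewrite mxE]; rewrite ?le_mx_norm.
rewrite (le_lt_trans (mulmx_bound _ _)) //.
have := abs_sum_ge0 K; move: zw; rewrite ltr_pdivlMr //.
by have := normr_ge0 (z - w); nra.
Qed.

(** No point is at the centre of rotation, and no two are collinear with it. *)
Definition general_position (p : vertex C -> 'cV[R]_2) :=
  (forall i, p i != 0) /\
  forall i j, i != j -> p i 0 0 * p j 1 0 - p i 1 0 * p j 0 0 != 0.

(** Subtracting a multiple of the rotation field makes the motion vanish at [i0]. At any other [j]
    it is then orthogonal to both [p0 i0] and [p0 j], which are linearly independent. *)
Lemma gram_motions_trivial (u : 'rV[R]_N) : general_position p0 ->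
  (forall i j, u *m W i *m (row_of p0 *m W j)^T + row_of p0 *m W i *m (u *m W j)^T = 0) ->
  (u <= row_of p0 *m J)%MS.
Proof.
move=> [p_neq0 p_det] hu; set y := row_of p0 in hu *.
have yW i : y *m W i = (p0 i)^T by rewrite row_of_mul.
case: (pickP (mem (vertex C))) => [i0 _|V0]; last first.
  suff -> : u = 0 by exact: sub0mx.
  by apply: eq_row_vertex => i; have := V0 i.
have y0 i : y *m W i != 0 by rewrite yW trmx_eq0.
have self i : u *m W i *m (y *m W i)^T = 0.
  have swap : y *m W i *m (u *m W i)^T = u *m W i *m (y *m W i)^T.
    by rewrite -[LHS]trmx11 [LHS]trmx_mul trmxK.
  have := hu i i; rewrite swap -mulr2n -scaler_nat => /eqP.
  by rewrite scaler_eq0 pnatr_eq0 => /eqP.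
have [c hc] := perp2 (y0 i0) (self i0).
pose v := u - c *: (y *m J).
have yJ i : y *m J *m W i = y *m W i *m quarter_turn R.
  by rewrite -mulmxA block_mx_ofE mulmxA.
have vW i : v *m W i = u *m W i - c *: (y *m W i *m quarter_turn R).
  by rewrite mulmxBl -scalemxAl yJ.
have v0 : v *m W i0 = 0 by rewrite vW hc subrr.
have vself j : v *m W j *m (y *m W j)^T = 0.
  by rewrite vW mulmxBl self -scalemxAl quarter_turn_perp scaler0 subrr.
have vcross j : v *m W j *m (y *m W i0)^T = 0.
  have := hu j i0; rewrite hc => h.
  rewrite vW mulmxBl -!scalemxAl -[RHS]h; congr (_ + _).
  have -> : (c *: (y *m W i0 *m quarter_turn R))^T =
      - c *: (quarter_turn R *m (y *m W i0)^T).
    by rewrite linearZ /= trmx_mul trmx_quarter_turn mulNmx scalerN scaleNr.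
  by rewrite -scalemxAr scaleNr mulmxA.
suff -> : u = c *: (y *m J) by exact: scalemx_sub.
apply/eqP; rewrite -subr_eq0 -/v; apply/eqP/eq_row_vertex => j; rewrite mul0mx.
have [->//|ji0] := eqVneq j i0.
have entry (a : 'rV[R]_2) (b : 'cV[R]_2) : a *m b^T^T = 0 -> a 0 0 * b 0 0 + a 0 1 * b 1 0 = 0.
  by move=> /matrixP/(_ 0 0); rewrite !mxE sum2E !mxE.
have := vself j; have := vcross j; rewrite !yW => /entry e1 /entry e2.
have d := p_det _ _ ji0.
have f1 t := congr1 ( *%R t) e1; have f2 t := congr1 ( *%R t) e2.
apply/rowP; apply: ord2P; rewrite [RHS]mxE; apply: (mulIf d); rewrite mul0r.
  by have := f1 (p0 j 1 0); have := f2 (p0 i0 1 0); lra.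
by have := f1 (p0 j 0 0); have := f2 (p0 i0 0 0); lra.
Qed.

Theorem not_rigid_of_rank : general_position p0 ->
  (forall x, \rank (span_of (rigidity_row D x) A) <=
             \rank (span_of (rigidity_row D (row_of p0)) A))%N ->
  (\rank (span_of (rigidity_row D (row_of p0)) A) + 2 <= N)%N ->
  ~ rigid aV len (extension p0).
Proof.
move=> gp maxr rA [x xE [_ [V Vx VE]]].
set y := row_of p0 in maxr rA.
(* As a quadratic form, [S i j] is twice the inner product of the points [i] and [j]. *)
pose S i j := W i *m (W j)^T + W j *m (W i)^T.
have symS i j : (S i j)^T = S i j by rewrite /S linearD /= !trmx_mul !trmxK addrC.
have [i [j nS]] : exists i j, ~ (y *m S i j <= span_of (rigidity_row D y) A)%MS.
  apply: contrapT => none.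
  have allS i j : (y *m S i j <= span_of (rigidity_row D y) A)%MS.
    by apply: contrapT => h; apply: none; exists i, j.
  (* If every such gradient were in the row space, all infinitesimal motions would preserve inner
     products and form a space of dimension at most 1. *)
  suff : (kermx (span_of (rigidity_row D y) A)^T <= y *m J)%MS.
    move=> /mxrankS; rewrite mxrank_ker mxrank_tr => /leq_trans/(_ (rank_leq_row _)).
    by rewrite leq_subLR => /(leq_trans rA); rewrite leq_add2l.
  apply/row_subP => l; have := row_sub l (kermx (span_of (rigidity_row D y) A)^T).
  move: (row l _) => u; rewrite sub_kermx => /eqP uk.
  apply: gram_motions_trivial => // i j.
  have /submxP[B SB] := allS i j.
  have -> : y *m W i *m (u *m W j)^T = u *m W j *m (y *m W i)^T.
    by rewrite -[LHS]trmx11 [LHS]trmx_mul trmxK.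
  have -> : u *m W i *m (y *m W j)^T + u *m W j *m (y *m W i)^T = u *m S i j *m y^T.
    by rewrite /S mulmxDr mulmxDl !trmx_mul !mulmxA.
  by rewrite -(symS i j) -mulmxA -trmx_mul SB trmx_mul mulmxA uk mul0mx.
move: Vx; rewrite nbhsE => -[V' [oV' V'x] V'V].
have oV'x : open (\pi_(config_space aV len)%qT @^-1` V') := oV'.
have [_ /= [[U oU <-] Ux] UV] : nbhs x (\pi_(config_space aV len)%qT @^-1` V').
  by apply: open_nbhs_nbhs.
have nU : \forall z \near y, U (extension (placement_of z)).
  apply: extension_continuous; rewrite row_ofK -xE.
  exact: open_nbhs_nbhs.
have /nbhs_ballP[eps /= eps0 heps] := nU.
have [z [zy zlen zS]] := flex maxr (symS i j) nS eps0.
have Uz : U (extension (placement_of z)).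
  by apply: heps; rewrite -ball_normE /= distrC.
have zR : realizations aV len (extension (placement_of z)).
  apply/realizationsE; split=> [g l|e eA]; first exact: extension_act.
  rewrite -[RHS](zlen e eA); congr sqlen; rewrite -[RHS]placement_ofK; congr row_of.
  by apply/funext => l; rewrite extension_rep.
pose x' : realizations aV len := 
  exist (fun P => P \in realizations aV len) _ (mem_set zR).
have Vx' : (V `&` setT) (\pi_(config_space aV len)%qT x').
  by split=> //; apply/V'V/(UV x').
(* Isolation would make the flexed realization congruent to the original one, but congruences
   preserve inner products. *)
move: Vx'; rewrite VE => /esym /eqmodP /asboolP[f Cf fE].
apply: zS.
have dot l : z *m W l = (f (p0 l))^T.
  have := fE (rep l); rewrite /= extension_rep xE extension_rep => <-.
  by rewrite /placement_of trmxK.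
have gram (w : 'rV[R]_N) : w *m S i j *m w^T =
    w *m W i *m (w *m W j)^T + w *m W j *m (w *m W i)^T.
  by rewrite /S mulmxDr mulmxDl !trmx_mul !mulmxA.
by rewrite !gram !dot !row_of_mul !trmxK !(Cent_dot hk Cf).
Qed.

End RigidityCriteria.

(** * Generic points *)

Section QuotientLifts.
Variables (R : realType) (k : nat) (hk : (1 < k)%N).
Variables (H : sym_graph k) (C : colored_graph k) (q : colored_quotient H C).
Local Notation D := (@edge_mx R k C).

Lemma projV_act i (g : 'Z_k) : projV q (actV H (rep q i) g) = i.
Proof.
rewrite -[RHS](rep_proj q); apply/esym/(projV_orbit q).
by apply: mem_orbit; rewrite inE.
Qed.

Lemma lift_vertex_inj i : injective (lift_vertex q i).
Proof.
move=> g h; rewrite /lift_vertex => /(congr1 (fun x => actV H x (- h))).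
have act_opp x (a b : 'Z_k) : actV H (actV H x a) b = actV H x (a + b).
  by rewrite -actM.
rewrite !act_opp subrr -[(0 : 'Z_k)]/(1%g) act1 => /actV_free /eqP.
by rewrite subr_eq0 => /eqP.
Qed.

Lemma vertex_offset_act i (g : 'Z_k) : vertex_offset q (actV H (rep q i) g) = g.
Proof.
rewrite /vertex_offset projV_act; case: pickP => [h /eqP|/(_ g)].
  exact: lift_vertex_inj.
by rewrite /lift_vertex eqxx.
Qed.

Lemma act_vertex_offset x : actV H (rep q (projV q x)) (vertex_offset q x) = x.
Proof.
have /orbitP[g _ gx] : x \in orbit (actV H) [set: 'Z_k]%SET (rep q (projV q x)).
  by apply/(projV_orbit q); rewrite rep_proj.
by rewrite -{1 2}gx projV_act vertex_offset_act.
Qed.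

(** Every edge of the orbit is a rotated copy of one lift, possibly with its endpoints listed in the
    other order. *)
Lemma edge_lengthE (P : placement R H) (e : edge H) :
  (forall (g : 'Z_k) i, P (actV H i g) = rot g (P i)) ->
  edist (P (edge_src e)) (P (edge_dst e)) ^+ 2 =
  sqlen D (projE q e) (row_of (fun i => P (rep q i))).
Proof.
move=> symP; have [e0 he0] := edge_lift q (projE q e).
have /orbitP[g _ eg] : e \in orbit (actE H) [set: 'Z_k]%SET e0.
  apply/(projE_orbit q); have [<- _] := he0 0.
  by rewrite -[(0 : 'Z_k)]/(1%g) act1.
have [_] := he0 g; rewrite eg => endsE.
rewrite sqlen_edge_mx; set i := edge_src _ in endsE *; set j := edge_dst _ in endsE *.
have PE : edist (P (lift_vertex q i g)) (P (lift_vertex q j (g + color (projE q e)))) ^+ 2 =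
    sqnorm (rot (color (projE q e)) (P (rep q j)) - P (rep q i)).
  by rewrite /lift_vertex !symP rotD // edist_rot edist_sqr.
by case: (ends_eq endsE) => -[-> ->]; rewrite -PE // edist_sym.
Qed.

Lemma projE_surj c : exists e, projE q e = c.
Proof. by have [e0 /(_ 0)[<- _]] := edge_lift q c; exists (actE H e0 0). Qed.

(** A loop of color 0 would lift to a loop of [H]. *)
Lemma loop_color_neq0 (c : edge C) : loopless H ->
  edge_src c = edge_dst c -> color c != 0.
Proof.
move=> hH loop; have [e0 /(_ 0)[_ endsE]] := edge_lift q c.
apply: contraNneq (hH (actE H e0 0)) => c0.
by move: endsE; rewrite c0 addr0 loop => /ends_eq[] [-> ->].
Qed.

(** [f] lists the edges present: it is the identity for the full graph and [val] after deletion of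
    an orbit. *)
Lemma realizations_projE (p : vertex C -> 'cV[R]_2) (I : finType) (f : I -> edge H)
    (A : {set edge C}) (P : placement R H) :
  (forall c, c \in A <-> exists i, projE q (f i) = c) ->
  (forall (g : 'Z_k) i, P (actV H i g) = rot g (P i)) ->
  (forall i, edist (P (edge_src (f i))) (P (edge_dst (f i))) ^+ 2 =
             induced_length (symmetric_placement q p) (f i) ^+ 2) <->
  (forall c, c \in A ->
     sqlen D c (row_of (fun i => P (rep q i))) = sqlen D c (row_of p)).
Proof.
move=> fA symP.
have lenE e : induced_length (symmetric_placement q p) e ^+ 2 =
    sqlen D (projE q e) (row_of p).
  rewrite edge_lengthE => [|g i].
    congr (sqlen _ _ (row_of _)); apply/funext => i.
    exact: (extension_rep projV_act vertex_offset_act).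
  exact: (extension_act hk act_vertex_offset projV_act vertex_offset_act).
split=> [h c /fA[i <-]|h i]; first by rewrite -edge_lengthE // h lenE.
by rewrite edge_lengthE // lenE h //; apply/fA; exists i.
Qed.

End QuotientLifts.

Section GenericPoints.
Variables (R : realType) (k : nat) (hk : (1 < k)%N) (C : colored_graph k).
Local Notation N := #|{: vertex C * 'I_2}|.
Local Notation D := (@edge_mx R k C).
Local Notation W := (@vertex_mx R (vertex C)).
Local Notation rank_at x := (\rank (span_of (rigidity_row D x) [set: edge C]%SET)).
Hypothesis loop_color : forall e : edge C, edge_src e = edge_dst e -> color e != 0.

(** Take a minor of a basis of the rows at a point of maximal rank: where it is nonzero, as many
    rows are independent. *)
Lemma max_rank_minor : exists f : 'rV[R]_N -> R,
  [/\ polynomial_fun f, exists x, f x != 0 &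
    forall x, f x != 0 -> forall x', (rank_at x' <= rank_at x)%N].
Proof.
have [||r /asboolP[x0 <-] maxr] := @ex_maxnP (fun r => `[< exists x, rank_at x = r >]) N.
- by exists (rank_at 0); apply/asboolP; exists 0.
- by move=> r /asboolP[x <-]; exact: rank_leq_col.
have [B [_ iB spanB]] := basis_exists (rigidity_row D x0) [set: edge C]%SET.
have [K [K0 KB]] := independent_minor iB.
exists (fun x => \det (\matrix_b (x *m K b))); split.
- apply: polynomial_det => b c; under eq_fun do rewrite mxE.
  exact: polynomial_mulmx.
- by exists x0.
move=> x /KB iBx x'; apply: (@leq_trans (rank_at x0)).
  by apply: maxr; apply/asboolP; exists x'.
apply: leq_trans (mxrankS spanB) _; rewrite (independent_rank iB).
apply: leq_trans iBx (mxrankS (span_ofS (rigidity_row D x) (finset.subsetT B))).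
Qed.

Lemma sqlen_neq0 e (x : 'rV[R]_N) : (sqlen D e x != 0) = (x *m D e != 0).
Proof.
rewrite /sqlen mulmxA -mulmxA -trmx_mul; apply/negP/negP => h /eqP h0; apply: h.
  by rewrite h0 mul0mx mxE.
apply/eqP/row_sqr_eq0/matrixP => i j; by rewrite !ord1 h0 mxE.
Qed.

Let e0 : 'cV[R]_2 := delta_mx 0 0.

Let unit_vector : e0 != 0.
Proof.
apply/eqP => /matrixP/(_ 0 0)/eqP.
by rewrite !mxE oner_eq0.
Qed.

(** A loop has nonzero color, so any nonzero position of its vertex works; for another edge, only
    its target is moved off the origin. *)
Lemma sqlen_nonroot e : exists x, sqlen D e x != 0.
Proof.
have [loop|/eqP noloop] := eqVneq (edge_src e) (edge_dst e).
  exists (row_of (fun=> e0)); rewrite sqlen_neq0; apply: contraNneq (loop_color loop).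
  move=> /edge_mx_ker; rewrite !row_of_mul => /(row_rot_free hk) -> //.
  by rewrite trmx_eq0.
exists (row_of (fun i => if i == edge_dst e then e0 else 0)).
rewrite sqlen_neq0; apply: contraNneq unit_vector => /edge_mx_ker.
rewrite !row_of_mul eqxx (introF eqP noloop) trmx0.
move=> /(congr1 (mulmx^~ (row_rot R (- color e)))).
by rewrite -mulmxA row_rotK // mulmx1 mul0mx => /eqP; rewrite trmx_eq0.
Qed.

Theorem generic_polynomial : exists f : 'rV[R]_N -> R,
  [/\ polynomial_fun f, exists x, f x != 0 &
    forall p, f (row_of p) != 0 ->
      [/\ forall x, (rank_at x <= rank_at (row_of p))%N, general_position p &
          forall e, sqlen D e (row_of p) != 0]].
Proof.
have [minor [minorP minor0 max_minor]] := max_rank_minor.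
(* The factors certify maximal rank, points off the origin, pairwise non-collinearity with it and
   positive lengths. For [i = j] the determinant is identically zero, so 1 replaces it. *)
pose g (s : option (vertex C + (vertex C * vertex C) + edge C)%type) (x : 'rV[R]_N) : R :=
  match s with
  | None => minor x
  | Some (inl (inl i)) => (x *m W i) 0 0 * (x *m W i) 0 0 + (x *m W i) 0 1 * (x *m W i) 0 1
  | Some (inl (inr (i, j))) =>
      if i == j then 1 else
        (x *m W i) 0 0 * (x *m W j) 0 1 + (-1) * ((x *m W i) 0 1 * (x *m W j) 0 0)
  | Some (inr e) => \sum_a (x *m (D e *m (D e)^T)) 0 a * x 0 a
  end.
have sqlenE e x : g (Some (inr e)) x = sqlen D e x.
  by rewrite /sqlen mxE; apply: eq_bigr => a _; congr (_ * _); rewrite mxE.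
have gP s : polynomial_fun (g s).
  rewrite /g; case: s => [[[i|[i j]]|e]|].
  - by apply: polynomialD; apply: polynomialM; exact: polynomial_mulmx.
  - case: (i == j); first exact: polynomial_const.
    apply: polynomialD; last apply: polynomialM; try exact: polynomial_const;
      by apply: polynomialM; exact: polynomial_mulmx.
  - apply: polynomial_sum => a; apply: polynomialM; first exact: polynomial_mulmx.
    exact: polynomial_coord.
  - exact: minorP.
have g0 s : exists x, g s x != 0.
  case: s => [[[i|[i j]]|e]|].
  - exists (row_of (fun=> e0)); rewrite /g row_of_mul !mxE /=.
    by rewrite mulr0 addr0 mulr1 oner_neq0.
  - rewrite /g; case: eqVneq => [_|ij]; first by exists 0; exact: oner_neq0.
    exists (row_of (fun l => if l == i then delta_mx 0 0 else delta_mx 1 0)).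
    have ji : (j == i) = false by rewrite eq_sym; exact: negPf.
    rewrite !row_of_mul eqxx ji !mxE /=.
    by rewrite !mulr0 addr0 mulr1 oner_neq0.
  - by have [x hx] := sqlen_nonroot e; exists x; rewrite sqlenE.
  - exact: minor0.
exists (fun x => \prod_s g s x); split.
- exact: polynomial_prod.
- have [x hx] := common_nonroot (fun s => polynomial_line_poly (gP s)) g0.
  by exists x; apply/prodf_neq0.
move=> p /prodf_neq0 gp; split=> [||e].
- by apply: max_minor; exact: (gp None).
- split=> [i|i j ij].
    have := gp (Some (inl (inl i))) isT; rewrite /g row_of_mul.
    by apply: contra_neq => ->; rewrite trmx0 !mxE mulr0 addr0.
  have := gp (Some (inl (inr (i, j)))) isT; rewrite /g (negPf ij) !row_of_mul !mxE.
  by rewrite mulN1r.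
- by rewrite -sqlenE; exact: gp.
Qed.

End GenericPoints.

(** * Minimal rigidity of generic rotation frameworks *)

Theorem theorem1 (R : realType) (k : nat) (hk : (2 <= k)%N)
    (H : sym_graph k) (hH : loopless H)
    (C : colored_graph k) (q : colored_quotient H C) :
  exists Z : set (vertex C -> 'cV[R]_2),
    proper_algebraic_subset Z /\
    forall p : vertex C -> 'cV[R]_2, ~ Z p ->
      (forall e : edge H, 0 < induced_length (symmetric_placement q p) e) /\
      (minimally_rigid (induced_length (symmetric_placement q p))
                       (symmetric_placement q p) <-> cone_laman C).
Proof.
have loop_color c := loop_color_neq0 q (c := c) hH.
have [f [[s fs] [x0 fx0] generic]] := generic_polynomial R hk loop_color.
have coordE p : (fun a => row_of p 0 a) = coordinates p :> ('I__ -> R).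
  by apply/funext => a; rewrite mxE.
exists [set p | forall g : mpoly _ R, g \in [:: s] -> meval (coordinates p) g = 0].
split.
  split; first by exists [:: s].
  move=> ZT; have : [set: vertex C -> 'cV[R]_2] (placement_of x0) by [].
  rewrite -ZT => /(_ s (mem_head _ _)); rewrite -coordE placement_ofK -fs.
  exact/eqP.
move=> p /= Zp; have [|maxr gp len_neq0] := generic p.
  apply: contra_notN Zp => /eqP fp g; rewrite inE => /eqP->.
  by rewrite -coordE -fs.
set P := symmetric_placement q p; set y := row_of p in maxr len_neq0.
have symP (g : 'Z_k) i : P (actV H i g) = rot g (P i).
  exact: (extension_act hk (@act_vertex_offset _ _ _ q) (@projV_act _ _ _ q)
    (@vertex_offset_act _ _ _ q)).
have Prep : (fun i => P (rep q i)) = p.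
  apply/funext => i.
  exact: (extension_rep (@projV_act _ _ _ q) (@vertex_offset_act _ _ _ q)).
split.
  move=> e; rewrite lt_neqAle sqrtr_ge0 andbT eq_sym -sqrf_eq0.
  by rewrite (edge_lengthE hk q e symP) Prep.
pose N := #|{: vertex C * 'I_2}|.
have N2 : (2 <= N)%N.
  rewrite /N card_coordinates; have /card_gt0P[v _] := sg_nonempty H.
  have : (0 < #|vertex C|)%N by apply/card_gt0P; exists (projV q v).
  by lia.
have realT (P' : placement R H) :
    realizations (actV H) (induced_length P) P' <->
    (forall (g : 'Z_k) i, P' (actV H i g) = rot g (P' i)) /\
    forall c, c \in [set: edge C]%SET ->
      sqlen (@edge_mx R k C) c (row_of (fun i => P' (rep q i))) =
      sqlen (@edge_mx R k C) c y.
  have projT c : c \in [set: edge C]%SET <-> exists e, projE q e = c.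
    by split=> // _; exact: projE_surj.
  split=> -[h1 h2]; split=> //.
    exact/(realizations_projE hk (f := id) p projT h2).
  exact/(realizations_projE hk (f := id) p projT h1).
have realD e (G' := del_edges (orbit (actE H) [set: 'Z_k]%SET e)) (P' : placement R G') :
    realizations (G := G') (actV H) (fun e' => induced_length P (val e')) P' <->
    (forall (g : 'Z_k) i, P' (actV H i g) = rot g (P' i)) /\
    forall c, c \in [set~ projE q e]%SET ->
      sqlen (@edge_mx R k C) c (row_of (fun i => P' (rep q i))) =
      sqlen (@edge_mx R k C) c y.
  have projD c : c \in [set~ projE q e]%SET <->
      exists e' : edge G', projE q (val e') = c.
    rewrite !inE; split=> [ce|[e' <-]]; last first.
      by apply: contra (valP e') => /eqP/esym/projE_orbit.
    have [e' e'c] := projE_surj q c.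
    have e'N : e' \notin orbit (actE H) [set: 'Z_k]%SET e.
      by apply: contra ce => /(projE_orbit q) ->; rewrite e'c.
    by exists (exist _ e' e'N).
  split=> -[h1 h2]; split=> //.
    exact/(realizations_projE hk p projD h2).
  exact/(realizations_projE hk p projD h1).
have rigidT := rigid_of_rank hk (@act_vertex_offset _ _ _ q) (@projV_act _ _ _ q)
    (@vertex_offset_act _ _ _ q) realT N2.
have not_rigidT := not_rigid_of_rank hk (@act_vertex_offset _ _ _ q) (@projV_act _ _ _ q)
    (@vertex_offset_act _ _ _ q) realT gp.
have rigidD e := rigid_of_rank
    (G := del_edges (orbit (actE H) [set: 'Z_k]%SET e)) hk
    (@act_vertex_offset _ _ _ q) (@projV_act _ _ _ q)
    (@vertex_offset_act _ _ _ q) (realD e) N2.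
have not_rigidD e := not_rigid_of_rank
    (G := del_edges (orbit (actE H) [set: 'Z_k]%SET e)) hk
    (@act_vertex_offset _ _ _ q) (@projV_act _ _ _ q)
    (@vertex_offset_act _ _ _ q) (realD e) gp.
rewrite (cone_laman_independent R hk C) -/N.
pose span A := span_of (rigidity_row (@edge_mx R k C) y) A.
split=> [[rig minrig]|[hN [x ix]]].
  have rank_ge : (N <= (\rank (span [set: edge C]%SET)).+1)%N.
    rewrite leqNgt; apply/negP => lt_rank; apply: not_rigidT rig => //.
    by rewrite addn2.
  have [B [_ iB spanB]] := basis_exists (rigidity_row (@edge_mx R k C) y) [set: edge C]%SET.
  (* Deleting the orbit of an edge outside the basis would keep the rank, hence rigidity, against
     minimality. *)
  have BT : B = [set: edge C]%SET.
    apply/setP => c; rewrite [RHS]inE; apply: contraT => cB.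
    have [e ec] := projE_surj q c; case: (minrig e); apply: rigidD.
    apply: leq_trans rank_ge _; rewrite ltnS; apply/mxrankS/(submx_trans spanB)/span_ofS.
    apply/fintype.subsetP => c' c'B; rewrite !inE; apply: contraNneq cB => c'e.
    by rewrite -ec -c'e.
  rewrite BT in iB; split; last by exists y.
  move: rank_ge; rewrite /span (independent_rank iB) cardsT => ge_N.
  apply/eqP; rewrite eqn_leq ge_N ltn_neqAle /=.
  have rank_le : (#|edge C| <= N)%N.
    by rewrite -cardsT (leq_trans iB) // rank_leq_col.
  (* With [N] independent rows the rotation field at [y] would vanish, and all points would be at
     the origin. *)
  rewrite rank_le andbT; apply/eqP => eqN.
  have [v _] : exists v : vertex C, true.
    have /card_gt0P[w _] : (0 < #|vertex C|)%N by move: N2; rewrite /N card_coordinates; lia.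
    by exists w.
  case: gp => /(_ v) /eqP p0 _; apply: p0.
  have : y *m turn_mx R (vertex C) = 0.
    apply: (full_rank_ker0 (M := span [set: edge C]%SET)).
      by rewrite /span (independent_rank iB) cardsT eqN.
    rewrite -[LHS]trmxK trmx_mul trmxK -[RHS]trmx0; congr trmx.
    apply/eqP; rewrite -sub_kermx; apply/span_of_ker => c _.
    exact: (rigidity_row_turn (@turn_edge_mx R k C)).
  move=> /eqP; rewrite (turn_eq0 (turn_mx_sqr R (vertex C))) => /eqP y0.
  by rewrite -[p]row_ofK -/y y0 /placement_of mul0mx trmx0.
have iy : independent (rigidity_row (@edge_mx R k C) y) [set: edge C]%SET.
  exact: leq_trans ix (maxr x).
split.
  by apply: rigidT; rewrite (independent_rank iy) cardsT -/N hN.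
(* After deletion [N - 2] independent rows remain: the rank is maximal, being the number of rows,
   and the corank is 2. *)
move=> e; apply: not_rigidD => [x'|].
  apply: leq_trans (independentS (finset.subsetT _) iy).
  by rewrite -[#|_|]mul1n rank_span_of.
rewrite (independent_rank (independentS (finset.subsetT _) iy)) cardsC1 -/N hN.
have : (0 < #|edge C|)%N by apply/card_gt0P; exists (projE q e).
by lia.
Qed.
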